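(* Let $J:\mathbb{R}^M\to\mathbb{R}$ and the stochastic recursion $\boldsymbol{w}_i=\boldsymbol{w}_{i-1}-\mu\nabla J(\boldsymbol{w}_{i-1})-\mu\,\boldsymbol{s}_i(\boldsymbol{w}_{i-1})$, started at $w_0$, satisfy the assumptions listed in the context. Suppose $J(w)\ge J^o$. Then, for sufficiently small step-sizes $\mu$, we have with probability $1-\pi$ that $\boldsymbol{w}_{i^o}\in\mathcal{M}$, i.e., $\|\nabla J(\boldsymbol{w}_{i^o})\|^2\le O(\mu)$ and $\lambda_{\min}\left(\nabla^2J(\boldsymbol{w}_{i^o})\right)\ge-\tau$, in at most $i^o$ iterations, where $$ i^o \le \frac{\left( J(w_{0}) - J^o \right)}{\mu^2 c_2 \pi}\, i^s $$ and $i^s$ denotes the escape time $$ i^{s} = \frac{\log\left( 2 M \frac{\sigma^2}{\sigma_{\ell}^2} + 1 + O(\mu) \right)}{\log(1 + 2\mu\tau)} \le O\left(\frac{1}{\mu \tau} \right). $$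
   Context: Setting. $J(w)=\mathbb{E}_{\boldsymbol{x}}Q(w;\boldsymbol{x})$ is a risk function on $\mathbb{R}^M$, the expectation of a loss $Q$ over the distribution of the data $\boldsymbol{x}$. With a constant step-size $\mu>0$ and starting point $w_0\in\mathbb{R}^M$, the iterates are $\boldsymbol{w}_i=\boldsymbol{w}_{i-1}-\mu\,\widehat{\nabla J}(\boldsymbol{w}_{i-1})$, where $\widehat{\nabla J}(\boldsymbol{w}_{i-1})$ is a (generally random) update direction approximating $\nabla J(\boldsymbol{w}_{i-1})$. The gradient noise is $\boldsymbol{s}_i(\boldsymbol{w}_{i-1})=\widehat{\nabla J}(\boldsymbol{w}_{i-1})-\nabla J(\boldsymbol{w}_{i-1})$, so that $\boldsymbol{w}_i=\boldsymbol{w}_{i-1}-\mu\nabla J(\boldsymbol{w}_{i-1})-\mu\,\boldsymbol{s}_i(\boldsymbol{w}_{i-1})$. $\boldsymbol{\mathcal{F}}_i$ is the filtration generated by $\boldsymbol{w}_0,\dots,\boldsymbol{w}_i$. Assumptions. (1) There is $\delta>0$ with $\|\nabla J(x)-\nabla J(y)\|\le\delta\|x-y\|$ for all $x,y$. (2) $J$ is twice differentiable and there is $\rho\ge0$ with $\|\nabla^2J(x)-\nabla^2J(y)\|\le\rho\|x-y\|$ for all $x,y$. (3) $\mathbb{E}\{\boldsymbol{s}_i(\boldsymbol{w}_{i-1})|\boldsymbol{\mathcal{F}}_{i-1}\}=0$ and $\mathbb{E}\{\|\boldsymbol{s}_i(\boldsymbol{w}_{i-1})\|^4|\boldsymbol{\mathcal{F}}_{i-1}\}\le\beta^4\|\nabla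 J(\boldsymbol{w}_{i-1})\|^4+\sigma^4$ for some non-negative constants $\beta^4,\sigma^4$. (4) The covariance $R_s(\boldsymbol{w}_{i-1})=\mathbb{E}\{\boldsymbol{s}_i(\boldsymbol{w}_{i-1})\boldsymbol{s}_i(\boldsymbol{w}_{i-1})^{\mathsf T}|\boldsymbol{\mathcal{F}}_{i-1}\}$ satisfies $\|R_s(x)-R_s(y)\|\le\beta_R\|x-y\|^{\gamma}$ for some $\beta_R$ and $0<\gamma\le4$. (5) There is $\sigma_\ell^2>0$ such that for every $w\in\mathcal{H}$ (defined below), with eigendecomposition $\nabla^2J(w)=V\Lambda V^{\mathsf T}$, $V=[V^{\ge0}\ \ V^{<0}]$, $\Lambda=\mathrm{diag}(\Lambda^{\ge0},\Lambda^{<0})$, where $\Lambda^{\ge0}\ge0$ and $\Lambda^{<0}<0$, one has $\lambda_{\min}\left((V^{<0})^{\mathsf T}R_s(w)V^{<0}\right)\ge\sigma_\ell^2$. Sets and constants. Let $\tau$ be a small positive parameter, $0<\pi<1$ a parameter to be chosen, $c_1=1-\mu\frac{\delta}{2}(1+\beta^2)=O(1)$ and $c_2=\frac{\delta}{2}\sigma^2=O(1)$. Define $\mathcal{G}=\{w:\|\nabla J(w)\|^2\ge\mu\frac{c_2}{c_1}(1+\frac1\pi)\}$, its complement $\mathcal{G}^C=\{w:\|\nabla J(w)\|^2<\mu\frac{c_2}{c_1}(1+\frac1\pi)\}$, $\mathcal{H}=\{w\in\mathcal{G}^C:\lambda_{\min}(\nabla^2J(w))\le-\tau\}$ (approximate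 strict saddle-points) and $\mathcal{M}=\{w\in\mathcal{G}^C:\lambda_{\min}(\nabla^2J(w))>-\tau\}$ (approximately second-order stationary points). The escape time $i^s$ is the number of iterations after which, starting from $\boldsymbol{w}_i\in\mathcal{H}$, one is guaranteed $\mathbb{E}\{J(\boldsymbol{w}_{i+i^s})|\boldsymbol{w}_i\in\mathcal{H}\}\le\mathbb{E}\{J(\boldsymbol{w}_i)|\boldsymbol{w}_i\in\mathcal{H}\}-\frac{\mu}{2}M\sigma^2+o(\mu)$. The symbols $O(\cdot)$ and $o(\cdot)$ refer to small step-sizes, $\mu\to0$. *)

(* Defs.v *)
From HB Require Import structures.
From mathcomp Require Import all_boot all_order all_algebra.
From mathcomp Require Import all_classical all_reals all_analysis.
Set Implicit Arguments.
Unset Strict Implicit.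
Unset Printing Implicit Defensive.
Import Order.TTheory GRing.Theory Num.Theory.
Import numFieldNormedType.Exports.
Local Open Scope classical_set_scope.
Local Open Scope ring_scope.

(* Vectors of R^M are row vectors 'rV_M.  The library norm on matrices is the
   sup norm, so the Euclidean norm and the spectral norm are defined here. *)
Definition enorm (R : realType) (m : nat) (v : 'rV[R]_m) : R :=
  Num.sqrt (\sum_(k < m) v 0 k ^+ 2).

Definition specnorm (R : realType) (m p : nat) (A : 'M[R]_(m, p)) : R :=
  sup [set enorm (v *m A) | v in [set v : 'rV[R]_m | enorm v <= 1]].

(* Meant for symmetric matrices of positive size, whose set of real
   eigenvalues is finite and nonempty: the infimum is then a minimum. *)
Definition lambda_min (R : realType) (m : nat) (A : 'M[R]_m) : R :=
  inf [set a : R | eigenvalue A a].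

Definition grad (R : realType) (m : nat) (J : 'rV[R]_m -> R) (x : 'rV[R]_m)
  : 'rV[R]_m :=
  \row_k 'D_(delta_mx 0 k) J x.

Definition hess (R : realType) (m : nat) (J : 'rV[R]_m -> R) (x : 'rV[R]_m)
  : 'M[R]_m :=
  jacobian (grad J) x.

Definition lipschitz_gradient (R : realType) (m : nat) (J : 'rV[R]_m -> R)
    (delta : R) : Prop :=
  forall x y, enorm (grad J x - grad J y) <= delta * enorm (x - y).

Definition twice_differentiable (R : realType) (m : nat) (J : 'rV[R]_m -> R)
  : Prop :=
  (forall x, differentiable J x) /\ (forall x, differentiable (grad J) x).

Definition lipschitz_hessian (R : realType) (m : nat) (J : 'rV[R]_m -> R)
    (rho : R) : Prop :=
  forall x y, specnorm (hess J x - hess J y) <= rho * enorm (x - y).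

Definition hoelder_covariance (R : realType) (m : nat)
    (Rs : 'rV[R]_m -> 'M[R]_m) (betaR gamma : R) : Prop :=
  forall x y, specnorm (Rs x - Rs y) <= betaR * (enorm (x - y)) `^ gamma.

(* [ghat i x t] is the update direction drawn at iteration [i] for the point
   [x] when the outcome is [t]; only the indices [i >= 1] are used. *)
Fixpoint iterates (R : realType) (m : nat) (T : Type)
    (ghat : nat -> 'rV[R]_m -> T -> 'rV[R]_m) (mu : R) (w0 : 'rV[R]_m)
    (i : nat) (t : T) : 'rV[R]_m :=
  match i with
  | 0%N => w0
  | i'.+1 => let w := iterates ghat mu w0 i' t in w - mu *: ghat i'.+1 w t
  end.

Definition gradient_noise (R : realType) (m : nat) (T : Type)
    (J : 'rV[R]_m -> R) (ghat : nat -> 'rV[R]_m -> T -> 'rV[R]_m)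
    (i : nat) (x : 'rV[R]_m) (t : T) : 'rV[R]_m :=
  ghat i x t - grad J x.

(* s_(i+1)(w_i) *)
Definition noise_along (R : realType) (m : nat) (T : Type)
    (J : 'rV[R]_m -> R) (ghat : nat -> 'rV[R]_m -> T -> 'rV[R]_m)
    (mu : R) (w0 : 'rV[R]_m) (i : nat) (t : T) : 'rV[R]_m :=
  gradient_noise J ghat i.+1 (iterates ghat mu w0 i t) t.

(* The sigma-algebra generated by w_0, ..., w_i, through their coordinates. *)
Definition filtration (R : realType) (m : nat) (T : Type)
    (w : nat -> T -> 'rV[R]_m) (i : nat) : set (set T) :=
  <<s [set A | exists (j : nat) (k : 'I_m) (B : set R),
         [/\ (j <= i)%N, measurable B & A = [set t | B (w j t 0 k)]] ] >>.

(* Y is a version of the conditional expectation E{X | F}. *)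
Definition is_cond_exp (R : realType) (d : measure_display)
    (T : measurableType d) (P : probability T R) (F : set (set T))
    (X Y : T -> R) : Prop :=
  [/\ P.-integrable setT (EFin \o X),
      P.-integrable setT (EFin \o Y),
      forall B : set R, measurable B -> F (Y @^-1` B) &
      forall A : set T, F A ->
        (\int[P]_(t in A) (X t)%:E = \int[P]_(t in A) (Y t)%:E)%E].

Definition noise_moments (R : realType) (m : nat) (d : measure_display)
    (T : measurableType d) (P : probability T R) (J : 'rV[R]_m -> R)
    (ghat : nat -> 'rV[R]_m -> T -> 'rV[R]_m) (w0 : 'rV[R]_m)
    (beta sigma mu : R) : Prop :=
  let w := iterates ghat mu w0 in
  let s := noise_along J ghat mu w0 in
  forall i : nat,
    (forall k : 'I_m,
       is_cond_exp P (filtration w i) (fun t => s i t 0 k) (fun=> 0)) /\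
    (exists Y : T -> R,
       is_cond_exp P (filtration w i) (fun t => enorm (s i t) ^+ 4) Y /\
       {ae P, forall t,
          Y t <= beta ^+ 4 * enorm (grad J (w i t)) ^+ 4 + sigma ^+ 4}).

Definition noise_covariance (R : realType) (m : nat) (d : measure_display)
    (T : measurableType d) (P : probability T R) (J : 'rV[R]_m -> R)
    (ghat : nat -> 'rV[R]_m -> T -> 'rV[R]_m) (w0 : 'rV[R]_m)
    (Rs : 'rV[R]_m -> 'M[R]_m) (mu : R) : Prop :=
  let w := iterates ghat mu w0 in
  let s := noise_along J ghat mu w0 in
  forall (i : nat) (k l : 'I_m),
    is_cond_exp P (filtration w i)
      (fun t => ((s i t)^T *m s i t) k l) (fun t => Rs (w i t) k l).

(* The one-step descent inequality given by the delta-Lipschitz gradient reads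
   E{J(w_(i+1)) | F_i} <= J(w_i) - mu c1 |grad J(w_i)|^2 + mu^2 c2. *)
Definition c1 (R : realType) (delta beta mu : R) : R :=
  1 - mu * (delta / 2) * (1 + beta ^+ 2).

Definition c2 (R : realType) (delta sigma : R) : R := delta / 2 * sigma ^+ 2.

(* The sets G, H and M, where [p] is the parameter pi in (0, 1): the target set
   M is to be reached with probability 1 - p. *)
Definition large_gradient (R : realType) (m : nat) (J : 'rV[R]_m -> R)
    (delta beta sigma p mu : R) : set 'rV[R]_m :=
  [set w | mu * (c2 delta sigma / c1 delta beta mu) * (1 + p^-1)
           <= enorm (grad J w) ^+ 2].

Definition strict_saddle (R : realType) (m : nat) (J : 'rV[R]_m -> R)
    (delta beta sigma p tau mu : R) : set 'rV[R]_m :=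
  ~` large_gradient J delta beta sigma p mu
  `&` [set w | lambda_min (hess J w) <= - tau].

Definition second_order_stationary (R : realType) (m : nat)
    (J : 'rV[R]_m -> R) (delta beta sigma p tau mu : R) : set 'rV[R]_m :=
  ~` large_gradient J delta beta sigma p mu
  `&` [set w | - tau < lambda_min (hess J w)].

(* H = V diag(Lp, Ln) V^T with V = [Vp Vn] orthogonal, Lp >= 0 and Ln < 0;
   orthogonality forces p + q = m. *)
Definition signed_eigendecomposition (R : realType) (m p q : nat)
    (H : 'M[R]_m) (Vp : 'M[R]_(m, p)) (Vn : 'M[R]_(m, q))
    (Lp : 'rV[R]_p) (Ln : 'rV[R]_q) : Prop :=
  let V := row_mx Vp Vn in
  [/\ V^T *m V = 1%:M, V *m V^T = 1%:M,
      H = V *m diag_mx (row_mx Lp Ln) *m V^T,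
      forall k, 0 <= Lp 0 k & forall k, Ln 0 k < 0].

Definition noise_at_saddles (R : realType) (m : nat) (J : 'rV[R]_m -> R)
    (Rs : 'rV[R]_m -> 'M[R]_m) (sigmal : R) (S : set 'rV[R]_m) : Prop :=
  forall w, S w ->
    exists (p q : nat) (Vp : 'M[R]_(m, p)) (Vn : 'M[R]_(m, q))
      (Lp : 'rV[R]_p) (Ln : 'rV[R]_q),
      signed_eigendecomposition (hess J w) Vp Vn Lp Ln /\
      sigmal ^+ 2 <= lambda_min (Vn^T *m Rs w *m Vn).

(* [r] is the remainder written O(mu) in the formula. *)
Definition escape_time (R : realType) (m : nat) (sigma sigmal tau : R)
    (r : R -> R) (mu : R) : R :=
  ln (2 * m%:R * (sigma ^+ 2 / sigmal ^+ 2) + 1 + r mu)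
  / ln (1 + 2 * mu * tau).

(* Main.v *)
(* Started in G, one step of the recursion lowers the expected risk by at least
   mu^2 c2 / p. Started at a strict saddle-point x, L = O(1/mu) steps lower it by at least
   mu^2 L. Indeed the descent lemma reads
   E J(w_(i+1)) <= E J(w_i) - mu c1 E|grad J(w_i)|^2 + mu^2 c2, so it is enough that the
   squared gradients sum to a large constant. Along a unit eigenvector v of the Hessian at
   x for an eigenvalue -l <= - tau, the gradient z of the quadratic model satisfies
   z' = (1 + mu l) z + mu l <v, s> up to an error controlled by E|w_i - x|^4 = O(mu^2), and
   the noise has variance at least sigmal^2 / 2 along v; hence E z_i^2 grows at least like
   i mu^2, and the sum of these over L steps is a multiple of (mu L)^2.
   As long as M has not been visited, the expected risk therefore decreases by at least
   k mu^2 per step, with k = min(1, c2), and it is bounded below by Jo: M is visited before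
   time (J w0 - Jo) / (k mu^2 p) with probability at least 1 - p. Since the escape time is
   of order 1 / mu, this is far below the bound of the theorem, whose O(mu) remainder can
   be taken equal to 0. *)
Require Import Defs.
From HB Require Import structures.
From mathcomp Require Import all_boot all_order all_algebra.
From mathcomp Require Import all_classical all_reals all_analysis.
From mathcomp Require Import measurable_realfun.
From mathcomp Require Import ring lra.
Set Implicit Arguments.
Unset Strict Implicit.
Unset Printing Implicit Defensive.
Import Order.TTheory GRing.Theory Num.Theory.
Import numFieldNormedType.Exports.
Local Open Scope classical_set_scope.
Local Open Scope ring_scope.

(** * Euclidean geometry and Taylor estimates *)

Section Euclidean.
Context {R : realType} {m : nat}.
Implicit Types u v w : 'rV[R]_m.

(** Every estimate is an inequality between integrals over an arbitrary event of [filtration w i].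
    Conditional expectations enter only through such integrals, and weights known at time [i] are
    inserted by approximating them with functions constant on events of that sigma-algebra. An
    estimate of this form can be restarted on any event known at the restarting time, which takes
    the place of stopping times. Fourth powers of the distance appear because the Taylor error of
    the gradient is quadratic in the distance and gets squared; the same moment absorbs the
    variation of the noise covariance, as [gamma <= 4]. It stays of order [mu ^+ 2] during 1/mu
    steps because the noise is centred and the squared gradient at the reference point is itself of
    order [mu]. The descent over [L] steps is valid wherever the path goes in between, so an epoch
    is never cut short, even if it crosses M. The remaining obstacle is that the reference point and
    its unstable direction are random; both are frozen on small cells of the event. *)

Definition dotv u v : R := \sum_(k < m) u 0 k * v 0 k.

Lemma dotvC u v : dotv u v = dotv v u.
Proof. by apply: eq_bigr => k _; rewrite mulrC. Qed.

Lemma dotvDl u v w : dotv (u + v) w = dotv u w + dotv v w.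
Proof. by rewrite /dotv -big_split/=; apply: eq_bigr => k _; rewrite mxE mulrDl. Qed.

Lemma dotvDr u v w : dotv w (u + v) = dotv w u + dotv w v.
Proof. by rewrite dotvC dotvDl ![dotv _ w]dotvC. Qed.

Lemma dotvZl (a : R) u v : dotv (a *: u) v = a * dotv u v.
Proof. by rewrite /dotv mulr_sumr; apply: eq_bigr => k _; rewrite mxE mulrA. Qed.

Lemma dotvZr (a : R) u v : dotv u (a *: v) = a * dotv u v.
Proof. by rewrite dotvC dotvZl dotvC. Qed.

Lemma dotvNl u v : dotv (- u) v = - dotv u v.
Proof. by rewrite -scaleN1r dotvZl mulN1r. Qed.

Lemma dotvNr u v : dotv u (- v) = - dotv u v.
Proof. by rewrite dotvC dotvNl dotvC. Qed.

Lemma dotvBl u v w : dotv (u - v) w = dotv u w - dotv v w.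
Proof. by rewrite dotvDl dotvNl. Qed.

Lemma dotvBr u v w : dotv w (u - v) = dotv w u - dotv w v.
Proof. by rewrite dotvDr dotvNr. Qed.

Lemma dotv0l v : dotv 0 v = 0.
Proof. by rewrite -(scale0r 0) dotvZl mul0r. Qed.

Lemma dotvv_ge0 u : 0 <= dotv u u.
Proof. by apply: sumr_ge0 => k _; rewrite -expr2 sqr_ge0. Qed.

Lemma dotv_mulmx u v : dotv u v = (u *m v^T) 0 0.
Proof. by rewrite mxE; apply: eq_bigr => k _; rewrite mxE. Qed.

Lemma enormE u : enorm u = Num.sqrt (dotv u u).
Proof. by congr Num.sqrt; apply: eq_bigr => k _; rewrite expr2. Qed.

Lemma sqr_enorm u : enorm u ^+ 2 = dotv u u.
Proof. by rewrite enormE sqr_sqrtr// dotvv_ge0. Qed.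

Lemma enorm_ge0 u : 0 <= enorm u.
Proof. exact: sqrtr_ge0. Qed.

Lemma dotvv_eq0 u : (dotv u u == 0) = (u == 0).
Proof.
apply/eqP/eqP => [|->]; last exact: dotv0l.
move=> /eqP; rewrite psumr_eq0 => [|k _]; last by rewrite -expr2 sqr_ge0.
move=> /allP h; apply/rowP => k; have := h k (mem_index_enum _).
by rewrite -expr2 sqrf_eq0 mxE => /eqP.
Qed.

Lemma dotv_CS_sqr u v : dotv u v ^+ 2 <= dotv u u * dotv v v.
Proof.
have [/eqP|vn0] := eqVneq (dotv v v) 0.
  rewrite dotvv_eq0 => /eqP ->.
  by rewrite dotvC dotv0l expr0n/= dotv0l mulr0.
have := dotvv_ge0 (dotv v v *: u - dotv u v *: v).
rewrite !(dotvBl, dotvBr, dotvZl, dotvZr) (dotvC v u) => h.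
rewrite -subr_ge0 -(@pmulr_rge0 _ (dotv v v)) ?lt0r ?vn0 ?dotvv_ge0//.
by apply: le_trans h _; rewrite le_eqVlt; apply/orP; left; apply/eqP; ring.
Qed.

Lemma dotv_CS u v : `|dotv u v| <= enorm u * enorm v.
Proof.
rewrite -(@ler_pXn2r _ 2)// ?nnegrE ?mulr_ge0 ?enorm_ge0 ?normr_ge0//.
by rewrite real_normK ?num_real// exprMn !sqr_enorm dotv_CS_sqr.
Qed.

Lemma dotvD_le u v : dotv (u + v) (u + v) <= 2 * dotv u u + 2 * dotv v v.
Proof.
have := dotvv_ge0 (u - v).
by rewrite !(dotvBl, dotvBr, dotvDl, dotvDr) (dotvC v u) => h; lra.
Qed.

Lemma dotvD_sq_le u v :
  dotv (u + v) (u + v) ^+ 2 <= 8 * (dotv u u ^+ 2 + dotv v v ^+ 2).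
Proof.
have h := dotvD_le u v; have h0 := dotvv_ge0 (u + v).
have hu := dotvv_ge0 u; have hv := dotvv_ge0 v.
move: (dotv _ _) (dotv u u) (dotv v v) h h0 hu hv => a b c h h0 hb hc.
have : a ^+ 2 <= (2 * b + 2 * c) ^+ 2 by rewrite ler_pXn2r// nnegrE//; lra.
by have := sqr_ge0 (b - c); nra.
Qed.

Lemma enormZ (a : R) u : enorm (a *: u) = `|a| * enorm u.
Proof.
by rewrite !enormE dotvZl dotvZr mulrA -expr2 sqrtrM ?sqr_ge0// sqrtr_sqr.
Qed.

Lemma normr_coord_le u (k : 'I_m) : `|u 0 k| <= enorm u.
Proof.
rewrite -(@ler_pXn2r _ 2)// ?nnegrE ?enorm_ge0 ?normr_ge0//.
rewrite real_normK ?num_real// sqr_enorm /dotv (bigD1 k)//= -expr2 lerDl.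
by apply: sumr_ge0 => i _; rewrite -expr2 sqr_ge0.
Qed.

Lemma normr_coordM_le u v (k : 'I_m) : `|u 0 k * v 0 k| <= enorm u * enorm v.
Proof. by rewrite normrM ler_pM// normr_coord_le. Qed.

Lemma normr_coordM_le_dotv u v (k : 'I_m) :
  `|u 0 k * v 0 k| <= dotv u u + dotv v v.
Proof.
apply: le_trans (normr_coordM_le u v k) _; rewrite -!sqr_enorm.
move: (enorm u) (enorm v) => a b.
by have := sqr_ge0 (a - b); have := sqr_ge0 a; have := sqr_ge0 b; nra.
Qed.

Lemma dotv_delta u (k : 'I_m) : dotv u (delta_mx 0 k) = u 0 k.
Proof.
rewrite /dotv (bigD1 k)//= mxE !eqxx mulr1 big1 ?addr0// => i ik.
by rewrite mxE eqxx/= (negbTE ik) mulr0.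
Qed.

End Euclidean.

Section Spectral_norm.
Context {R : realType} {m p : nat}.

Lemma dotv_mulmx_le (v : 'rV[R]_m) (A : 'M[R]_(m, p)) :
  dotv (v *m A) (v *m A) <= dotv v v * \sum_(k < p) \sum_(i < m) A i k ^+ 2.
Proof.
rewrite mulr_sumr; apply: ler_sum => k _; rewrite mxE.
have := dotv_CS_sqr v (\row_i A i k).
rewrite -expr2 /dotv; under eq_bigr do rewrite mxE.
move=> /le_trans; apply; apply: ler_wpM2l; first exact: dotvv_ge0.
by apply: ler_sum => i _; rewrite !mxE expr2.
Qed.

Lemma enorm_mulmx_le_specnorm (v : 'rV[R]_m) (A : 'M[R]_(m, p)) :
  enorm (v *m A) <= specnorm A * enorm v.
Proof.
have ub (u : 'rV[R]_m) : enorm u <= 1 -> enorm (u *m A) <= specnorm A.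
  move=> u1; apply: ub_le_sup; last by exists u.
  (* The Frobenius norm bounds the set, so the supremum defining [specnorm] is a genuine one. *)
  exists (Num.sqrt (\sum_(k < p) \sum_(i < m) A i k ^+ 2)) => _ [w /= w1 <-].
  rewrite enormE ler_wsqrtr// (le_trans (dotv_mulmx_le _ _))// ler_piMl//.
    by apply: sumr_ge0 => k _; apply: sumr_ge0 => i _; rewrite sqr_ge0.
  by rewrite -sqr_enorm exprn_ile1// enorm_ge0.
have [v0|v0] := eqVneq (enorm v) 0.
  have /eqP : dotv v v == 0 by rewrite -sqr_enorm v0 expr0n.
  move=> /eqP; rewrite dotvv_eq0 => /eqP ->.
  by rewrite mul0mx !enormE !dotv0l sqrtr0 mulr0.
have vp : 0 < enorm v by rewrite lt0r v0 enorm_ge0.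
have := ub ((enorm v)^-1 *: v).
rewrite -scalemxAl !enormZ ger0_norm ?invr_ge0 ?enorm_ge0// mulVf//.
by move=> /(_ (lexx _)); rewrite mulrC ler_pdivrMr.
Qed.

End Spectral_norm.

(** * Descent lemma, Taylor estimate for the gradient, bounds on the Hessian *)

Section Calculus.
Context {R : realType} {m : nat}.
Implicit Types x y h v : 'rV[R]_m.

Lemma is_derive_line (f : 'rV[R]_m -> R) x h (t : R) :
  differentiable f (x + t *: h) ->
  is_derive t (1 : R) (fun t => f (x + t *: h)) ('D_h f (x + t *: h)).
Proof.
move=> df; have dh := @diff_derivable _ _ _ f _ h df.
have e : (fun a : R => a^-1 *: (f (x + (a *: (1 : R) + t) *: h) - f (x + t *: h)))
       = (fun a : R => a^-1 *: (f (a *: h + (x + t *: h)) - f (x + t *: h))).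
  apply/funext => a; congr (_ *: (f _ - _)).
  by rewrite [a *: 1]mulr1 scalerDl addrCA.
by apply: DeriveDef; [rewrite /derivable e | rewrite /derive e].
Qed.

Lemma derive_grad (J : 'rV[R]_m -> R) x h :
  differentiable J x -> 'D_h J x = dotv (grad J x) h.
Proof.
move=> dJ; rewrite deriveE// {1}(row_sum_delta h) linear_sum.
by apply: eq_bigr => k _; rewrite linearZ/= mxE deriveE// mulrC.
Qed.

Lemma derive_dotv_grad (J : 'rV[R]_m -> R) x h v :
  differentiable (grad J) x ->
  differentiable (fun y => dotv v (grad J y)) x /\
  'D_h (fun y => dotv v (grad J y)) x = dotv v (h *m hess J x).
Proof.
move=> dg.
have dc k : differentiable (fun y => grad J y 0 k) x.
  by apply: (@differentiable_comp _ _ _ _ (grad J) (fun w : 'rV[R]_m => w 0 k)) => //;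
    exact: differentiable_coord.
have dk k : differentiable (fun y => v 0 k * grad J y 0 k) x.
  by apply: differentiableM => //; exact: differentiable_cst.
have e : (fun y => dotv v (grad J y)) = \sum_(k < m) (fun y => v 0 k * grad J y 0 k).
  by apply/funext => y; rewrite fct_sumE.
split; first by rewrite e; exact: differentiable_sum.
rewrite e derive_sum => [|k]; last exact: diff_derivable.
apply: eq_bigr => k _.
rewrite (@deriveM _ _ (fun=> v 0 k) (fun y => grad J y 0 k))//; last exact: diff_derivable.
rewrite derive_cst scaler0 addr0; congr (_ * _).
rewrite /hess -deriveEjacobian// derive_mx; last exact: diff_derivable.
by rewrite mxE.
Qed.

Lemma is_derive_quadratic (a b t : R) :
  is_derive t (1 : R) (fun t => t * a + t ^+ 2 * b) (a + 2 * t * b).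
Proof.
have -> : (fun t => t * a + t ^+ 2 * b) = (id : R -> R) * cst a + id * id * cst b.
  by apply/funext => u; rewrite expr2.
have di := is_derive_id t (1 : R).
apply: (is_derive_eq (is_deriveD (is_deriveM di (is_derive_cst a t 1))
  (is_deriveM (is_deriveM di di) (is_derive_cst b t 1)))).
by rewrite !fctE /GRing.scale/=; ring.
Qed.

(** The quadratic upper model is subtracted along the segment: by Cauchy-Schwarz the difference has
    a nonpositive derivative, so one application of the mean value theorem replaces an integral
    along the segment. *)
Lemma lipschitz_gradient_descent (J : 'rV[R]_m -> R) delta x h :
  (forall x, differentiable J x) -> lipschitz_gradient J delta ->
  J (x + h) <= J x + dotv (grad J x) h + delta / 2 * dotv h h.
Proof.
move=> dJ lJ.
pose q := fun t : R => t * dotv (grad J x) h + t ^+ 2 * (delta / 2 * dotv h h).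
pose phi := (fun t : R => J (x + t *: h)) - q.
pose dphi := fun t : R => dotv (grad J (x + t *: h) - grad J x) h - t * (delta * dotv h h).
have D t : is_derive t (1 : R) phi (dphi t).
  have d1 := is_derive_line (dJ (x + t *: h)).
  have d2 := is_derive_quadratic (dotv (grad J x) h) (delta / 2 * dotv h h) t.
  apply: is_derive_eq.
  by rewrite derive_grad// /dphi dotvBl; field.
have [c c01] := @MVT_segment R phi dphi 0 1 ler01 (fun t _ => D t)
  (derivable_within_continuous (fun t _ => @ex_derive _ _ _ _ _ _ _ (D t))).
rewrite /phi /q /= => e.
have c0 : 0 <= c by rewrite (itvP c01).
suff : dphi c <= 0.
  move: e; rewrite !fctE !scale0r !scale1r !addr0 => e h0.
  by rewrite expr1n !mul1r expr0n/= !mul0r in e; lra.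
rewrite /dphi subr_le0.
apply: le_trans (ler_norm _) _; apply: le_trans (dotv_CS _ _) _.
rewrite -sqr_enorm.
have := lJ (x + c *: h) x.
have -> : x + c *: h - x = c *: h by rewrite addrC addKr.
rewrite enormZ ger0_norm// => l.
apply: le_trans (ler_wpM2r (enorm_ge0 h) l) _.
by rewrite le_eqVlt; apply/orP; left; apply/eqP; ring.
Qed.

(** Pairing with [v] makes the gradient scalar along the segment, where the mean value theorem
    applies. It yields [rho] instead of the sharp [rho / 2], which only affects constants. *)
Lemma grad_taylor (J : 'rV[R]_m -> R) rho x h v :
  twice_differentiable J -> lipschitz_hessian J rho -> 0 <= rho -> enorm v <= 1 ->
  `|dotv v (grad J (x + h)) - dotv v (grad J x + h *m hess J x)| <= rho * dotv h h.
Proof.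
move=> [_ dJ] lJ rho0 v1.
pose phi := (fun t : R => dotv v (grad J (x + t *: h))).
pose dphi := fun t : R => dotv v (h *m hess J (x + t *: h)).
have D t : is_derive t (1 : R) phi (dphi t).
  have [d1 e] := derive_dotv_grad h v (dJ (x + t *: h)).
  have d2 := is_derive_line (h := h) d1.
  by apply: is_derive_eq.
have [c c01] := @MVT_segment R phi dphi 0 1 ler01 (fun t _ => D t)
  (derivable_within_continuous (fun t _ => @ex_derive _ _ _ _ _ _ _ (D t))).
rewrite /phi /= scale0r addr0 scale1r subr0 mulr1 => e.
have c0 : 0 <= c <= 1 by rewrite !(itvP c01).
rewrite dotvDr opprD addrA e /dphi -dotvBr -mulmxBr.
apply: le_trans (dotv_CS _ _) _.
apply: le_trans (ler_wpM2r (enorm_ge0 _) v1) _; rewrite mul1r.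
apply: le_trans (enorm_mulmx_le_specnorm _ _) _.
have := lJ (x + c *: h) x.
have -> : x + c *: h - x = c *: h by rewrite addrC addKr.
rewrite enormZ ger0_norm; last by case/andP: c0.
move=> l; rewrite -sqr_enorm expr2 mulrA ler_wpM2r ?enorm_ge0//.
apply: le_trans l _; rewrite ler_wpM2l// ler_piMl ?enorm_ge0//.
by case/andP: c0.
Qed.

(** The Hessian is a limit of difference quotients of the gradient, and each of these is bounded by
    the Lipschitz constant. *)
Lemma dotv_mul_hess_le (J : 'rV[R]_m -> R) delta x h v :
  (forall x, differentiable (grad J) x) -> lipschitz_gradient J delta ->
  dotv v (h *m hess J x) <= delta * enorm h * enorm v.
Proof.
move=> dJ lJ.
have [d1 e] := derive_dotv_grad h v (dJ x).
rewrite -e; apply: (@limr_le _ _ _ _ _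
  (fun a : R => a^-1 *: (dotv v (grad J (a *: h + x)) - dotv v (grad J x)))).
  by have := @diff_derivable _ _ _ _ _ h d1; rewrite /derivable.
near=> a.
have a0 : a != 0 by near: a; exact: nbhs_dnbhs_neq.
have -> : a^-1 *: (dotv v (grad J (a *: h + x)) - dotv v (grad J x))
    = dotv v (a^-1 *: (grad J (a *: h + x) - grad J x)).
  by rewrite dotvZr dotvBr.
apply: le_trans (ler_norm _) _.
apply: le_trans (dotv_CS _ _) _; rewrite mulrC ler_wpM2r ?enorm_ge0//.
rewrite enormZ normfV mulrC ler_pdivrMr ?normr_gt0//.
by have := lJ (a *: h + x) x; rewrite addrK enormZ => l; rewrite -mulrA (mulrC (enorm h)).
Unshelve. all: by end_near. Qed.

Lemma enorm_mul_hess_le (J : 'rV[R]_m -> R) delta x h :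
  0 <= delta ->
  (forall x, differentiable (grad J) x) -> lipschitz_gradient J delta ->
  enorm (h *m hess J x) <= delta * enorm h.
Proof.
move=> d0 dJ lJ; set u := h *m hess J x.
have := dotv_mul_hess_le x h u dJ lJ; rewrite -/u -sqr_enorm expr2.
have := enorm_ge0 u; rewrite le_eqVlt => /predU1P[<- _|u0].
  by rewrite mulr_ge0 ?enorm_ge0.
by rewrite ler_pM2r.
Qed.

Lemma grad_coord_continuous (J : 'rV[R]_m -> R) k :
  (forall x, differentiable (grad J) x) -> continuous (fun x => grad J x 0 k).
Proof.
move=> dJ x; apply: differentiable_continuous.
by apply: (@differentiable_comp _ _ _ _ (grad J) (fun w : 'rV[R]_m => w 0 k)) => //;
    exact: differentiable_coord.
Qed.

End Calculus.

(** * Eigenvalues of symmetric matrices and of the Hessian *)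

Section Rayleigh.
Context {R : realType}.

Lemma continuous_sumr (U : topologicalType) (I : finType) (f : I -> U -> R) :
  (forall i, continuous (f i)) -> continuous (fun x => \sum_i f i x).
Proof.
move=> cf; apply: (@continuous_big R I +%R 0 predT) => [xy|i _]; last exact: cf.
by apply: cvgD; [exact: cvg_fst | exact: cvg_snd].
Qed.

Lemma continuous_dotv_mulmx m (B : 'M[R]_m) :
  continuous (fun x : 'rV[R]_m => dotv x (x *m B)).
Proof.
have -> : (fun x : 'rV[R]_m => dotv x (x *m B)) =
    (fun x => \sum_(k < m) x 0 k * \sum_(i < m) x 0 i * B i k).
  by apply/funext => x; apply: eq_bigr => k _; rewrite mxE.
apply: continuous_sumr => k x.
apply: continuousM; first exact: coord_continuous.
apply: (@continuous_sumr _ _ (fun i (x : 'rV[R]_m) => x 0 i * B i k)) => i y.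
apply: continuousM; first exact: coord_continuous.
exact: cst_continuous.
Qed.

Lemma enorm_continuous m : continuous (@enorm R m).
Proof.
move=> x; rewrite (_ : @enorm R m = Num.sqrt \o (fun x => dotv x (x *m 1%:M))).
  apply: continuous_comp; first exact: continuous_dotv_mulmx.
  exact: sqrt_continuous.
by apply/funext => y /=; rewrite mulmx1 enormE.
Qed.

Lemma hess_entry_continuous m (J : 'rV[R]_m -> R) rho i j :
  lipschitz_hessian J rho -> continuous (fun x => hess J x i j).
Proof.
move=> lJ x.
have h y : `|hess J x i j - hess J y i j| <= rho * enorm (x - y).
  apply: le_trans (lJ x y).
  move: (hess J x) (hess J y) => a b.
  have -> : a i j - b i j = ((delta_mx 0 i : 'rV[R]_m) *m (a - b)) 0 j.
    by rewrite -rowE !mxE.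
  apply: le_trans (normr_coord_le _ _) _.
  apply: le_trans (enorm_mulmx_le_specnorm _ _) _.
  by rewrite [enorm (delta_mx 0 i)]enormE dotv_delta mxE !eqxx sqrtr1 mulr1.
have c : {for x, continuous (fun y : 'rV[R]_m => rho * enorm (x - y))}.
  apply: continuousM; first exact: cst_continuous.
  apply: (@continuous_comp _ _ _ (fun y : 'rV[R]_m => x - y) (@enorm R m)).
    by apply: continuousB; [exact: cst_continuous|exact: cvg_id].
  exact: enorm_continuous.
apply/(@cvgrPdist_lt _ _ _ _ (nbhs_filter (x : 'rV[R]_m))) => e e0.
have := (cvgr_lt _ c) e; rewrite subrr enormE dotv0l sqrtr0 mulr0.
move=> /(_ (nbhs_filter (x : 'rV[R]_m)) e0).
by apply: filterS => y; exact: le_lt_trans (h y).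
Qed.

Lemma dotv_mulmx_sym m (B : 'M[R]_m) (x y : 'rV[R]_m) :
  B^T = B -> dotv x (y *m B) = dotv y (x *m B).
Proof.
by move=> sB; rewrite (dotvC y) !dotv_mulmx trmx_mul sB mulmxA.
Qed.

Lemma sphere_compact m : compact [set x : 'rV[R]_m | dotv x x = 1].
Proof.
apply: bounded_closed_compact.
  exists 1; split; first exact: num_real.
  move=> M M1 x /= x1; rewrite [leLHS]/Num.Def.normr/= mx_normrE.
  apply/bigmax_leP; split => [|[i j] _]; first by rewrite ltW// (lt_trans _ M1).
  rewrite (ord1 i) (le_trans (normr_coord_le x j))// enormE x1 sqrtr1.
  exact: ltW.
have -> : [set x : 'rV[R]_m | dotv x x = 1] =
    (fun x => dotv x (x *m 1%:M)) @^-1` [set 1].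
  by apply/seteqP; split => x /=; rewrite mulmx1.
apply: preimage_closed => [x _|]; first exact: continuous_dotv_mulmx.
exact: closed_eq.
Qed.

(* The minimum of the quadratic form on the unit sphere is an eigenvalue, and
   every eigenvalue is a value of the form on the sphere. *)
Lemma lambda_min_le_dotv m (B : 'M[R]_m) (v : 'rV[R]_m) :
  B^T = B -> dotv v v = 1 -> lambda_min B <= dotv v (v *m B).
Proof.
move=> sB v1.
have [||c + cmin] := @EVT_min_rV R m (fun x => dotv x (x *m B)) _ _ (@sphere_compact m).
- by exists v.
- by apply: continuous_subspaceT => x; exact: continuous_dotv_mulmx.
rewrite inE/= => c1; set l := dotv c (c *m B) in cmin.
have hl (x : 'rV[R]_m) : 0 <= dotv x (x *m B) - l * dotv x x.
  have [/eqP|x0] := eqVneq (dotv x x) 0.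
    by rewrite dotvv_eq0 => /eqP ->; rewrite !dotv0l mulr0 subrr.
  have xp : 0 < dotv x x by rewrite lt0r x0 dotvv_ge0.
  have := cmin ((enorm x)^-1 *: x).
  rewrite inE/= -scalemxAl !dotvZl !dotvZr !mulrA -!expr2 exprVn sqr_enorm mulVf//.
  by move=> /(_ erefl); rewrite mulrC ler_pdivlMr// subr_ge0.
(* First-order condition at the minimizer: moving [c] along the residual [r] changes the form by
   [2 t <r, r>] plus a multiple of [t ^+ 2], which is negative for a small negative [t] unless
   [r = 0]. *)
have ev : c *m B = l *: c.
  apply/eqP; rewrite -subr_eq0 -dotvv_eq0; apply/eqP.
  have [r rE] : exists r, r = c *m B - l *: c by exists (c *m B - l *: c).
  rewrite -rE.
  have quad (t : R) : 0 <= 2 * t * dotv r r + t ^+ 2 * (dotv r (r *m B) - l * dotv r r).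
    have := hl (c + t *: r).
    rewrite mulmxDl -scalemxAl !(dotvDl, dotvDr, dotvZl, dotvZr).
    rewrite (dotv_mulmx_sym c r sB) (dotvC c r) -/l c1.
    have -> : dotv r r = dotv r (c *m B) - l * dotv r c.
      by rewrite -dotvZr -dotvBr -rE.
    move=> h; apply: le_trans h _; rewrite le_eqVlt; apply/orP; left; apply/eqP; ring.
  have r0 := dotvv_ge0 r.
  move: quad r0; move: (dotv r r) (dotv r (r *m B) - _) => a b quad a0.
  apply/eqP; rewrite eq_le a0 andbT leNgt; apply/negP => ap.
  have bp : 0 < `|b| + 1 by rewrite ltr_wpDl.
  have [s [sp sb]] : exists s, 0 < s /\ s * (`|b| + 1) = a.
    by exists (a / (`|b| + 1)); rewrite divr_gt0// divfK ?gt_eqF.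
  have sb' : s * b <= a.
    by rewrite -sb ler_wpM2l ?ltW// (le_lt_trans (ler_norm b))// ltrDl.
  have h := quad (- s).
  have h1 : s * (s * b) <= s * a by rewrite ler_wpM2l// ltW.
  have h2 : 0 < s * a by rewrite mulr_gt0.
  have e : 2 * - s * a + (- s) ^+ 2 * b = s * (s * b) - 2 * (s * a) by ring.
  by move: h; rewrite e; move: h1 h2; clear; lra.
apply: le_trans (_ : lambda_min B <= l) (cmin v _); last by rewrite inE.
apply: ge_inf.
  exists l => a /= /eigenvalueP[x xB x0].
  have xp : 0 < dotv x x by rewrite lt0r dotvv_eq0 x0 dotvv_ge0.
  by have := hl x; rewrite xB dotvZr -mulrBl pmulr_lge0// subr_ge0.
apply/eigenvalueP; exists c => //; apply/eqP => c0.
by move: c1; rewrite c0 dotv0l => /eqP; rewrite eq_sym oner_eq0.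
Qed.

End Rayleigh.

Section Eigenvalues.
Context {R : realType}.

Lemma eigenvalue_lbound m (A : 'M[R]_m) (B : R) :
  (forall x : 'rV[R]_m, enorm (x *m A) <= B * enorm x) ->
  forall a, eigenvalue A a -> - B <= a.
Proof.
move=> AB a /eigenvalueP[x xA x0].
have xp : 0 < enorm x.
  rewrite lt0r enorm_ge0 andbT; apply: contra x0 => /eqP x0.
  by rewrite -dotvv_eq0 -sqr_enorm x0 expr0n.
have := AB x; rewrite xA enormZ ler_pM2r// => h.
by rewrite lerNl (le_trans _ h)// -normrN ler_norm.
Qed.

(** The spectrum is the zero set of a polynomial, hence closed, and the infimum is attained. An
    empty spectrum would give the default infimum 0, which [0 < tau] excludes. *)
Lemma lambda_min_le m (A : 'M[R]_m) (B tau : R) : 0 < tau ->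
  (forall a, eigenvalue A a -> B <= a) ->
  lambda_min A <= - tau <-> exists2 a, eigenvalue A a & a <= - tau.
Proof.
move=> t0 AB; split => [h|[a aA at_]]; last first.
  by apply: le_trans at_; apply: ge_inf => //; exists B => b; exact: AB.
have hi : has_inf [set a | eigenvalue A a].
  split; last by exists B => b; exact: AB.
  apply/set0P/negP => /eqP e; move: h.
  by rewrite /lambda_min e inf0 leNgt oppr_lt0 t0.
exists (lambda_min A) => //.
rewrite eigenvalue_root_char; apply/negPn/negP => nr.
have : \forall x \near lambda_min A, (char_poly A).[x] != 0.
  exact: (cvgr_neq0 _ (@continuous_horner R (char_poly A) (lambda_min A)) nr).
case/nbhs_ballP => e /= e0 he.
have [b bA be] := inf_adherent e0 hi.
have := he b; rewrite /ball/= /ball_/=.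
have lb : lambda_min A <= b by apply: ge_inf => //; exact: hi.2.
rewrite ler0_norm ?subr_le0// opprB ltrBlDl => /(_ be).
by move: bA; rewrite /= eigenvalue_root_char /root => ->.
Qed.

(** In the coordinates [x *m V] an eigenvector of [H] becomes one of a diagonal matrix; any nonzero
    coordinate identifies the eigenvalue with a diagonal entry, and its sign places it in [Ln]. *)
Lemma signed_eigendecomposition_neg m p q (H : 'M[R]_m) (Vp : 'M[R]_(m, p))
    (Vn : 'M[R]_(m, q)) (Lp : 'rV[R]_p) (Ln : 'rV[R]_q) a :
  signed_eigendecomposition H Vp Vn Lp Ln -> eigenvalue H a -> a < 0 ->
  exists k, Ln 0 k = a.
Proof.
move=> [V1 V2 HE Lp0 Ln0] /eigenvalueP[x xH x0] a0.
set V := row_mx Vp Vn in V1 V2 HE; set D := row_mx Lp Ln in HE.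
have y0 : x *m V != 0.
  apply: contra x0 => /eqP e; apply/eqP.
  by rewrite -[x]mulmx1 -V2 mulmxA e mul0mx.
have yD : (x *m V) *m diag_mx D = a *: (x *m V).
  have := congr1 (mulmx^~ V) xH.
  by rewrite HE !mulmxA -[_ *m V^T *m V]mulmxA V1 mulmx1 -scalemxAl.
have [k yk] : exists k, (x *m V) 0 k != 0.
  apply/existsP; apply: contraR y0 => /existsPn h; apply/eqP/rowP => k.
  by rewrite [RHS]mxE; apply/eqP; rewrite -[_ == _]negbK h.
have := congr1 (fun z : 'rV[R]_(p + q) => z 0 k) yD.
rewrite mul_mx_diag [LHS]mxE [RHS]mxE mulrC => /(mulIf yk).
rewrite /D mxE; case: split_ordP => j kj; last by exists j.
by move=> e; have := Lp0 j; rewrite e leNgt a0.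
Qed.

(** The direction is the column of [Vn] that belongs to an eigenvalue [a <= - tau], with [l = - a].
    Its noise variance is a value of the quadratic form of [Vn^T *m Rs w *m Vn] on the unit sphere;
    symmetry of [Rs w] lets this be bounded below by the smallest eigenvalue. *)
Lemma noise_at_saddle_direction m (J : 'rV[R]_m -> R) (Rs : 'rV[R]_m -> 'M[R]_m)
    (sigmal tau B : R) (S : set 'rV[R]_m) w : 0 < tau ->
  (forall a, eigenvalue (hess J w) a -> B <= a) ->
  noise_at_saddles J Rs sigmal S -> S w -> lambda_min (hess J w) <= - tau ->
  (Rs w)^T = Rs w ->
  exists (v : 'rV[R]_m) (l : R), [/\ dotv v v = 1, tau <= l,
    forall u, dotv v (u *m hess J w) = - l * dotv v u &
    sigmal ^+ 2 <= dotv v (v *m Rs w)].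
Proof.
move=> t0 HB ns Sw /(lambda_min_le t0 HB)[a aH at_] sR.
have [p [q [Vp [Vn [Lp [Ln [dec hl]]]]]]] := ns _ Sw.
have a0 : a < 0 by rewrite (le_lt_trans at_)// oppr_lt0.
have [k ka] := signed_eigendecomposition_neg dec aH a0.
case: dec => V1 V2 HE _ _.
set V := row_mx Vp Vn in V1 V2 HE; set D := row_mx Lp Ln in HE.
pose e : 'rV[R]_q := delta_mx 0 k.
pose e' : 'rV[R]_(p + q) := delta_mx 0 (rshift p k).
have ee : dotv e e = 1 by rewrite dotv_delta mxE !eqxx.
have vE : e *m Vn^T = e' *m V^T by rewrite -!rowE /V tr_row_mx rowKd.
have DE : D 0 (rshift p k) = a by rewrite /D row_mxEr ka.
clearbody D.
have e'D : diag_mx D *m e'^T = a *: e'^T.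
  apply/matrixP => i j; rewrite mul_diag_mx !mxE (ord1 j).
  have [->|ik] := eqVneq i (rshift p k); last by rewrite !mulr0.
  by rewrite DE.
exists (e *m Vn^T), (- a); split.
- rewrite dotv_mulmx {2}vE trmx_mul trmxK vE mulmxA -(mulmxA e') V1 mulmx1 -dotv_mulmx.
  by rewrite dotv_delta mxE !eqxx.
- by rewrite lerNr.
- move=> u; rewrite opprK vE dotvC [in RHS]dotvC !dotv_mulmx trmx_mul trmxK HE.
  rewrite !mulmxA -(mulmxA _ V^T V) V1 mulmx1 -(mulmxA _ (diag_mx D)) e'D.
  by rewrite -scalemxAr mxE.
apply: le_trans hl _.
apply: le_trans (@lambda_min_le_dotv _ _ _ e _ ee) _.
  by rewrite !trmx_mul trmxK sR mulmxA.
by rewrite dotvC [leRHS]dotvC !dotv_mulmx trmx_mul trmxK !mulmxA.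
Qed.

End Eigenvalues.

(** * Measurability and integrals over sub-sigma-algebras *)

Section Measurable_vectors.
Context {R : realType} d {T : measurableType d} {m : nat}.

Lemma open_rational_box (U : set 'rV[R]_m) x : open U -> U x ->
  exists (c : 'rV[rat]_m) (e : rat), [/\ 0 < e,
    forall k, `|ratr (c 0 k) - x 0 k| < (ratr e : R) &
    forall y : 'rV[R]_m, (forall k, `|ratr (c 0 k) - y 0 k| < (ratr e : R)) -> U y].
Proof.
move=> oU Ux; have /nbhs_ballP[r /= r0 rU] := open_nbhs_nbhs (conj oU Ux).
have [e] := @rat_in_itvoo R 0 (r / 2) (divr_gt0 r0 (ltr0Sn R 1)).
rewrite in_itv/= => /andP[e0 er].
have ex k : exists q : rat, `|ratr q - x 0 k| < (ratr e : R).
  have [q] := @rat_in_itvoo R (x 0 k - ratr e) (x 0 k + ratr e) ltac:(lra).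
  by rewrite in_itv/= -ltr_distl; exists q.
have [c cP] := choice ex.
exists (\row_k c k), e; split; first by rewrite ltr0q in e0.
  by move=> k; rewrite mxE.
move=> y yP; apply: rU; split => // i j; rewrite (ord1 i).
have := yP j; rewrite mxE => h.
rewrite /ball/= (le_lt_trans (ler_distD (ratr (c j)) _ _))//.
by rewrite (splitr r) distrC ltrD// (lt_trans _ er).
Qed.

(** An open set is the union of the countably many rational boxes that it contains, and the preimage
    of a box is determined by coordinates, the only data through which the filtration is
    generated. *)
Lemma measurable_preimage_open (w : T -> 'rV[R]_m) (U : set 'rV[R]_m) :
  (forall k, measurable_fun setT (fun t => w t 0 k)) -> open U ->
  measurable (w @^-1` U).
Proof.
move=> mw oU.
pose box (q : 'rV[rat]_m * rat) : set T := if asbool (forall y : 'rV[R]_m,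
  (forall k, `|ratr (q.1 0 k) - y 0 k| < (ratr q.2 : R)) -> U y) then
  \bigcap_(k in [set: 'I_m]) [set t | `|ratr (q.1 0 k) - w t 0 k| < (ratr q.2 : R)]
  else set0.
have -> : w @^-1` U = \bigcup_q box q.
  apply/seteqP; split => [t Ut|t [q _]]; last first.
    rewrite /box; case: asboolP => // qU h.
    by apply: qU => k; exact: h.
  have [c [e [_ h1 h2]]] := open_rational_box oU Ut.
  exists (c, e) => //; rewrite /box asboolT// => k _; exact: h1.
apply: countable_bigcupT_measurable => [|q]; first exact: countableP.
rewrite /box; case: asboolP => // _.
apply: fin_bigcap_measurable => // k _.
rewrite -[X in measurable X]setTI.
have -> : [set t | `|ratr (q.1 0 k) - w t 0 k| < ratr q.2]
  = (fun t => `|ratr (q.1 0 k) - w t 0 k| < ratr q.2) @^-1` [set true] by [].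
apply: measurable_fun_ltr => //.
by apply: measurableT_comp => //; apply: measurable_funB.
Qed.

Lemma measurable_continuous_comp (w : T -> 'rV[R]_m) (f : 'rV[R]_m -> R) :
  (forall k, measurable_fun setT (fun t => w t 0 k)) -> continuous f ->
  measurable_fun setT (fun t => f (w t)).
Proof.
move=> mw /continuousP cf mT; apply: (measurability _ (RGenOpens.measurableE R)) => //.
move=> _ [_ [a [b ->] <-]]; rewrite setTI.
have -> : (fun t => f (w t)) @^-1` `]a, b[ = w @^-1` (f @^-1` `]a, b[) by [].
by apply: measurable_preimage_open => //; apply: cf; exact: interval_open.
Qed.

End Measurable_vectors.

(** * Measurability of spectral events and of cells *)

Section Measurable_spectrum.
Context {R : realType} d {T : measurableType d}.

Lemma measurable_set_lt (f g : T -> R) :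
  measurable_fun setT f -> measurable_fun setT g ->
  measurable [set t | f t < g t].
Proof.
move=> mf mg; rewrite -[X in measurable X]setTI.
have -> : [set t | f t < g t] = (fun t => f t < g t) @^-1` [set true] by [].
exact: measurable_fun_ltr.
Qed.

Lemma measurable_set_le (f g : T -> R) :
  measurable_fun setT f -> measurable_fun setT g ->
  measurable [set t | f t <= g t].
Proof.
move=> mf mg; rewrite -[X in measurable X]setTI.
have -> : [set t | f t <= g t] = (fun t => f t <= g t) @^-1` [set true] by [].
exact: measurable_fun_ler.
Qed.

Lemma measurable_det m (A : T -> 'M[R]_m) :
  (forall i j, measurable_fun setT (fun t => A t i j)) ->
  measurable_fun setT (fun t => \det (A t)).
Proof.
move=> mA; apply: measurable_sum => s; apply: measurable_funM => //.
by apply: measurable_prod => i _; exact: mA.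
Qed.

Lemma char_poly_det m (A : 'M[R]_m) a : (char_poly A).[a] = \det (a%:M - A).
Proof.
rewrite /char_poly -[LHS]/(horner_eval a _) -det_map_mx; congr (\det _).
by apply/matrixP => i j; rewrite !mxE /= /horner_eval hornerD hornerN hornerMn hornerX hornerC.
Qed.

(** The event says that the characteristic polynomial has a root in the compact interval from [B] to
    [- tau]. By compactness this means that it takes arbitrarily small values at rational
    parameters, which is a countable condition on determinants. *)
Lemma measurable_lambda_min_le m (A : T -> 'M[R]_m) (B tau : R) : 0 < tau ->
  (forall i j, measurable_fun setT (fun t => A t i j)) ->
  (forall t a, eigenvalue (A t) a -> B <= a) ->
  measurable [set t | lambda_min (A t) <= - tau].
Proof.
move=> tau0 mA AB.
have [Bt|tB] := leP B (- tau); last first.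
  rewrite (_ : [set t | _] = set0)//; apply/seteqP; split => // t /=.
  move=> /(lambda_min_le tau0 (AB t))[a /AB aB at_].
  by have := lt_le_trans tB aB; rewrite ltNge at_.
(* Rationals are projected onto the interval, which may be a single irrational point. *)
pose cl (x : R) := Num.max B (Num.min x (- tau)).
have clI x : cl x \in `[B, - tau].
  by rewrite in_itv/= le_max lexx/= ge_max Bt/= ge_min lexx orbT.
have clid x : x \in `[B, - tau] -> cl x = x.
  rewrite in_itv/= => /andP[h1 h2]; rewrite /cl.
  by rewrite (min_idPl h2) (max_idPr h1).
have cl1 a x : a \in `[B, - tau] -> `|cl x - a| <= `|x - a|.
  rewrite in_itv/= => /andP[h1 h2].
  have n1 := ler_norm (x - a); have n2 := ler_norm (a - x).
  rewrite distrC in n2; rewrite ler_norml.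
  by rewrite /cl /Num.max /Num.min; case: (ltP x (- tau)) => h3; case: ltP => h4; lra.
have -> : [set t | lambda_min (A t) <= - tau] = \bigcap_k \bigcup_(q : rat)
    [set t | `|\det ((cl (ratr q))%:M - A t)| < k.+1%:R^-1].
  apply/seteqP; split => t /=.
    move=> /(lambda_min_le tau0 (AB t))[a aA at_] k _.
    have aI : a \in `[B, - tau] by rewrite in_itv/= at_ (AB _ _ aA).
    have pa : (char_poly (A t)).[a] = 0.
      by apply/eqP; rewrite -[_ == 0]eigenvalue_root_char.
    have k0 : 0 < k.+1%:R^-1 :> R by rewrite invr_gt0.
    have near : \forall x \near a, `|(char_poly (A t)).[a] - (char_poly (A t)).[x]| < k.+1%:R^-1.
      by have /cvgrPdist_lt := @continuous_horner R (char_poly (A t)) a; apply.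
    case/nbhs_ballP : near => e /= e0 he.
    have [q] := @rat_in_itvoo R (a - e) (a + e) ltac:(lra).
    rewrite in_itv/= -ltr_distl => qa.
    exists q => //=; rewrite -char_poly_det.
    have := he (cl (ratr q)); rewrite /ball/= [X in X < e -> _]distrC.
    by rewrite (le_lt_trans (cl1 _ _ aI) qa) => /(_ isT); rewrite pa sub0r normrN.
  move=> h; apply/(lambda_min_le tau0 (AB t)).
  have [|c cI cmin] := @EVT_min R (fun x => `|(char_poly (A t)).[x]|) _ _ Bt.
    apply: continuous_subspaceT => x; apply: continuous_comp.
      exact: continuous_horner.
    exact: norm_continuous.
  exists c; last by move: cI; rewrite in_itv/= => /andP[].
  rewrite eigenvalue_root_char /root -normr_eq0 eq_le normr_ge0 andbT.
  apply/ler_addgt0Pl => e e0; rewrite addr0.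
  have [k ke] : exists k, k.+1%:R^-1 <= e.
    by exists (Num.truncn e^-1); rewrite invf_ple ?posrE// ltW// truncnS_gt.
  have [q _ /=] := h k I; rewrite -char_poly_det => hq.
  by rewrite (le_trans (cmin _ (clI (ratr q))))// (le_trans (ltW hq)).
apply: bigcapT_measurable => k; apply: bigcupT_measurable_rat => q.
apply: measurable_set_lt => //.
apply: measurableT_comp => //; apply: measurable_det => i j.
under eq_fun do rewrite !mxE.
exact: measurable_funB.
Qed.

Lemma measurable_fun_truncn (f : T -> R) :
  measurable_fun setT f -> measurable_fun setT (fun t => Num.truncn (f t)).
Proof.
move=> mf _ B _; rewrite setTI.
have -> : (fun t => Num.truncn (f t)) @^-1` B =
    \bigcup_(k in B) [set t | Num.truncn (f t) = k].
  apply/seteqP; split => [t Bt|t [k Bk /= tk]]; first by exists (Num.truncn (f t)).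
  by rewrite /= tk.
apply: bigcup_measurable => -[|k] _.
  rewrite (_ : [set t | _] = [set t | f t < 1%:R]); first exact: measurable_set_lt.
  apply/seteqP; split => t /=; rewrite -(truncn_le_nat (f t) 0); first by move=> ->.
  by rewrite leqn0 => /eqP.
rewrite (_ : [set t | _] = [set t | k.+1%:R <= f t] `&` [set t | f t < k.+2%:R]).
  by apply: measurableI; [exact: measurable_set_le|exact: measurable_set_lt].
apply/seteqP; split => t /=; rewrite -truncn_gt_nat -truncn_le_nat; first by move=> ->.
by move=> [h1 h2]; apply/eqP; rewrite eqn_leq h2.
Qed.

Lemma measurable_set_floor (f : T -> R) (z : int) :
  measurable_fun setT f -> measurable [set t | Num.floor (f t) = z].
Proof.
move=> mf.
rewrite (_ : [set t | _] = [set t | z%:~R <= f t] `&` [set t | f t < (z + 1)%:~R]).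
  by apply: measurableI; [exact: measurable_set_le|exact: measurable_set_lt].
apply/seteqP; split => t /=; first by move=> <-; have /andP[] := floor_itv (f t).
by move=> [h1 h2]; apply: floor_def; rewrite h1.
Qed.

End Measurable_spectrum.

(** * Integrals over events of a sub-sigma-algebra *)

Section Restricted_integrals.
Context {R : realType} d {T : measurableType d} (P : probability T R).
Implicit Types (D A : set T) (f g X Z : T -> R).

Lemma integrable_real_measurable f :
  P.-integrable setT (EFin \o f) -> measurable_fun setT f.
Proof. by move=> /measurable_int/measurable_EFinP. Qed.

Lemma integrable_realD D f g : measurable D ->
  P.-integrable D (EFin \o f) -> P.-integrable D (EFin \o g) ->
  P.-integrable D (EFin \o (fun t => f t + g t)).
Proof. by move=> mD fi gi; have := integrableD mD fi gi. Qed.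

Lemma integrable_realZ D (c : R) f : measurable D ->
  P.-integrable D (EFin \o f) -> P.-integrable D (EFin \o (fun t => c * f t)).
Proof. by move=> mD fi; have := integrableZl mD c fi. Qed.

Lemma integrable_realB D f g : measurable D ->
  P.-integrable D (EFin \o f) -> P.-integrable D (EFin \o g) ->
  P.-integrable D (EFin \o (fun t => f t - g t)).
Proof. by move=> mD fi gi; have := integrableB mD fi gi. Qed.

Lemma integrable_real_cst D (c : R) : measurable D ->
  P.-integrable D (EFin \o (fun=> c)).
Proof. by move=> mD; exact: finite_measure_integrable_cst. Qed.

Lemma integrable_real_sum (I : Type) (r : seq I) (f : I -> T -> R) :
  (forall i, P.-integrable setT (EFin \o f i)) ->
  P.-integrable setT (EFin \o (fun t => \sum_(i <- r) f i t)).
Proof.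
move=> fi; elim: r => [|i r IH].
  by under eq_fun do rewrite /= big_nil; exact: integrable_real_cst.
by under eq_fun do rewrite /= big_cons; exact: integrable_realD.
Qed.

Lemma integrable_real_le f g : measurable_fun setT f ->
  (forall t, `|f t| <= g t) ->
  P.-integrable setT (EFin \o g) -> P.-integrable setT (EFin \o f).
Proof.
move=> mf fg; apply: le_integrable => //; first exact/measurable_EFinP.
by move=> t _ /=; rewrite lee_fin (le_trans (fg t))// ler_norm.
Qed.

Lemma integrable_realS D f : measurable D ->
  P.-integrable setT (EFin \o f) -> P.-integrable D (EFin \o f).
Proof. by move=> mD; apply: integrableS. Qed.

Lemma le0_Rintegral_partition (A : set T) (l : T -> nat) (f : T -> R) :
  (forall k, measurable (A `&` l @^-1` [set k])) ->
  P.-integrable setT (EFin \o f) ->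
  (forall k, \int[P]_(t in A `&` l @^-1` [set k]) f t <= 0) ->
  \int[P]_(t in A) f t <= 0.
Proof.
move=> mA fi h.
have AE : A = \bigcup_k (A `&` l @^-1` [set k]).
  by rewrite -setI_bigcupr; apply/seteqP; split => [t At|t []//]; split => //; exists (l t).
have fi' (B : set T) : measurable B -> P.-integrable B (EFin \o f).
  by move=> mB; apply: integrableS fi.
rewrite /Rintegral {1}AE integral_bigcup//; last first.
- by apply: fi'; exact: bigcupT_measurable.
- move=> i j _ _ [t [[_ <-] [_ <-]]]; by [].
apply: fine_le0; apply: npeseries_le0 => k _ _.
have := h k; rewrite /Rintegral -lee_fin fineK//.
by apply: integrable_fin_num => //; exact: fi'.
Qed.

(* [Z] is a uniform limit of functions that are constant on the cells
   [floor (n Z) = k], and these cells belong to the sub-sigma-algebra. *)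
Lemma Rintegral_mulr_le0 (G : set (set T)) (X Z : T -> R) :
  <<s G >> `<=` @measurable d T ->
  P.-integrable setT (EFin \o X) ->
  P.-integrable setT (EFin \o (fun t => X t * Z t)) ->
  (forall t, 0 <= Z t) ->
  measurable_fun setT (Z : g_sigma_algebraType G -> R) ->
  (forall A, <<s G >> A -> \int[P]_(t in A) X t <= 0) ->
  forall A, <<s G >> A -> \int[P]_(t in A) (X t * Z t) <= 0.
Proof.
move=> sG iX iXZ Z0 mZ hX A GA.
have mA := sG _ GA.
have iS (f : T -> R) (B : set T) : measurable B ->
    P.-integrable setT (EFin \o f) -> P.-integrable B (EFin \o f).
  by move=> mB; apply: integrableS.
have mXT : measurable_fun setT X by apply/measurable_EFinP; apply: measurable_int iX.
have mZT : measurable_fun setT Z.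
  by move=> _ B mB; apply: sG; exact: (mZ measurableT B mB).
pose l (n : nat) t := Num.truncn (n.+1%:R * Z t).
have ml n k : <<s G >> (A `&` l n @^-1` [set k]).
  apply: (@measurableI _ (g_sigma_algebraType G)) => //.
  rewrite -[X in measurable X]setTI.
  apply: (@measurable_fun_truncn R _ (g_sigma_algebraType G)) => //.
  exact: measurable_funM.
pose Zn n t : R := (l n t)%:R / n.+1%:R.
have Zn_itv n t : Zn n t <= Z t <= Zn n t + n.+1%:R^-1.
  have := @truncn_itv R (n.+1%:R * Z t); rewrite mulr_ge0// => /(_ isT) /andP[h1 h2].
  rewrite /Zn ler_pdivrMr// mulrC h1/= -[X in _ + X]mul1r -mulrDl ler_pdivlMr//.
  by rewrite [Z t * _]mulrC natr1 ltW.
have mZn n : measurable_fun setT (Zn n).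
  apply: measurable_funM => //.
  apply: (@measurableT_comp _ _ _ _ _ _ (fun k : nat => k%:R : R)) => //.
  apply: (@measurable_fun_truncn R _ T) => //.
  exact: measurable_funM.
have iXZn n : P.-integrable setT (EFin \o (fun t => X t * Zn n t)).
  apply: le_integrable iXZ => //.
    by apply/measurable_EFinP; exact: measurable_funM.
  move=> t _ /=; rewrite lee_fin !normrM ler_wpM2l//.
  have /andP[h1 _] := Zn_itv n t.
  by rewrite !ger0_norm// /Zn divr_ge0.
have Zn_le0 n : \int[P]_(t in A) (X t * Zn n t) <= 0.
  apply: (@le0_Rintegral_partition _ (l n)) => // [k|k]; first exact: (sG _ (ml n k)).
  rewrite (@eq_Rintegral _ _ _ _ _ (fun t => k%:R / n.+1%:R * X t)); last first.
    by move=> t; rewrite inE => -[_ /= lk]; rewrite /Zn lk mulrC.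
  rewrite RintegralZl; [|exact: (sG _ (ml n k))|by apply: iS => //; exact: (sG _ (ml n k))].
  by rewrite mulr_ge0_le0 ?divr_ge0//; apply: hX; exact: ml.
set c := \int[P]_(t in A) `|X t|.
have inX : P.-integrable setT (EFin \o (fun t => `|X t|)).
  exact: integrable_norm.
(* [Z] exceeds [Zn n] by at most 1/(n+1), so the replacement costs at most that fraction of the
   integral of [|X|]. *)
have le n : \int[P]_(t in A) (X t * Z t) <= n.+1%:R^-1 * c.
  have iA := iS _ A mA inX; have iB := iS _ A mA (iXZn n).
  have iA' := integrable_realZ n.+1%:R^-1 mA iA.
  rewrite -[leRHS]addr0; apply: le_trans (lerD (lexx _) (Zn_le0 n)).
  rewrite /c -RintegralZl// -RintegralD//; apply: le_Rintegral => //; first exact: iS.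
    exact: integrable_realD.
  move=> t _; have /andP[h1 h2] := Zn_itv n t.
  rewrite -lerBlDr -mulrBr (le_trans (ler_norm _))// normrM mulrC ler_wpM2r//.
  by rewrite ger0_norm ?subr_ge0// lerBlDl.
apply/ler_addgt0Pl => e e0; rewrite addr0.
have c0 : 0 <= c by exact: Rintegral_ge0.
apply: le_trans (le (Num.truncn (c / e))) _.
rewrite mulrC ler_pdivrMr//.
have := truncnS_gt (c / e); rewrite ltr_pdivrMr// mulrC => /ltW.
exact.
Qed.

End Restricted_integrals.

Section Integral_lemmas.
Context {R : realType} d {T : measurableType d} (P : probability T R).

Lemma measurable_dotv {d'} {T' : measurableType d'} m (f g : T' -> 'rV[R]_m) :
  (forall k, measurable_fun setT (fun t => f t 0 k)) ->
  (forall k, measurable_fun setT (fun t => g t 0 k)) ->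
  measurable_fun setT (fun t => dotv (f t) (g t)).
Proof.
by move=> mf mg; apply: measurable_sum => k; exact: measurable_funM.
Qed.

(** A combination is stored as a list of pairs of a coefficient and a function. Each moment estimate
    can then integrate one pointwise polynomial inequality at once, with all integrability
    conditions gathered in a single conjunction. *)
Lemma Rintegral_lincomb (A : set T) (r : seq (R * (T -> R))) : measurable A ->
  foldr (fun p Q => P.-integrable setT (EFin \o p.2) /\ Q) True r ->
  P.-integrable setT (EFin \o (fun t => \sum_(p <- r) p.1 * p.2 t)) /\
  \int[P]_(t in A) (\sum_(p <- r) p.1 * p.2 t) =
  \sum_(p <- r) p.1 * \int[P]_(t in A) p.2 t.
Proof.
move=> mA; elim: r => [_|[c f] r IH /= [fi /IH[ri re]]].
  split; first by under eq_fun do rewrite big_nil; exact: integrable_real_cst.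
  by under eq_Rintegral do rewrite big_nil; rewrite big_nil Rintegral_cst// mul0r.
split.
  under eq_fun do rewrite big_cons/=.
  by apply: integrable_realD => //; exact: integrable_realZ.
under eq_Rintegral do rewrite big_cons/=.
rewrite RintegralD//; last 2 first.
- by apply: integrable_realS => //; exact: integrable_realZ.
- exact: integrable_realS.
by rewrite big_cons/= re RintegralZl//; exact: integrable_realS.
Qed.

Lemma Rintegral_le_lincomb (A : set T) (X : T -> R) (r : seq (R * (T -> R))) :
  measurable A -> P.-integrable setT (EFin \o X) ->
  foldr (fun p Q => P.-integrable setT (EFin \o p.2) /\ Q) True r ->
  (forall t, X t <= \sum_(p <- r) p.1 * p.2 t) ->
  \int[P]_(t in A) X t <= \sum_(p <- r) p.1 * \int[P]_(t in A) p.2 t.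
Proof.
move=> mA iX ir Xr; have [i1 <-] := Rintegral_lincomb mA ir.
by apply: le_Rintegral => //; exact: integrable_realS.
Qed.

Lemma Rintegral_ge_lincomb (A : set T) (X : T -> R) (r : seq (R * (T -> R))) :
  measurable A -> P.-integrable setT (EFin \o X) ->
  foldr (fun p Q => P.-integrable setT (EFin \o p.2) /\ Q) True r ->
  (forall t, \sum_(p <- r) p.1 * p.2 t <= X t) ->
  \sum_(p <- r) p.1 * \int[P]_(t in A) p.2 t <= \int[P]_(t in A) X t.
Proof.
move=> mA iX ir Xr; have [i1 <-] := Rintegral_lincomb mA ir.
by apply: le_Rintegral => //; exact: integrable_realS.
Qed.

Lemma Rintegral_sum (A : set T) (I : Type) (r : seq I) (f : I -> T -> R) :
  measurable A -> (forall i, P.-integrable setT (EFin \o f i)) ->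
  \int[P]_(t in A) (\sum_(i <- r) f i t) = \sum_(i <- r) \int[P]_(t in A) f i t.
Proof.
move=> mA fi; elim: r => [|k r IH].
  by under eq_Rintegral do rewrite big_nil; rewrite big_nil Rintegral_cst// mul0r.
under eq_Rintegral do rewrite big_cons.
by rewrite big_cons -IH RintegralD//; apply: integrable_realS => //; exact: integrable_real_sum.
Qed.

Lemma Rintegral_quadratic_form m (A : set T) (v : 'rV[R]_m) (M : T -> 'M[R]_m) :
  measurable A -> (forall k l, P.-integrable setT (EFin \o (fun t => M t k l))) ->
  P.-integrable setT (EFin \o (fun t => dotv v (v *m M t))) /\
  \int[P]_(t in A) dotv v (v *m M t) =
  \sum_k \sum_l (v 0 k * v 0 l) * \int[P]_(t in A) M t l k.
Proof.
move=> mA iM.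
have e : (fun t => dotv v (v *m M t)) =
    (fun t => \sum_k \sum_l (v 0 k * v 0 l) * M t l k).
  apply/funext => t; apply: eq_bigr => k _; rewrite mxE mulr_sumr.
  by apply: eq_bigr => l _; rewrite mulrA.
have i1 k l : P.-integrable setT (EFin \o (fun t => (v 0 k * v 0 l) * M t l k)).
  by apply: integrable_realZ => //; exact: iM.
have i2 k : P.-integrable setT (EFin \o (fun t => \sum_l (v 0 k * v 0 l) * M t l k)).
  by apply: integrable_real_sum => l; exact: i1.
split; first by rewrite e; apply: integrable_real_sum => k; exact: i2.
rewrite e Rintegral_sum//; apply: eq_bigr => k _; rewrite Rintegral_sum//.
by apply: eq_bigr => l _; rewrite RintegralZl//; apply: integrable_realS => //; exact: iM.
Qed.

(** The sign condition on the weight is met by writing [Z] as [(|Z| + Z) - |Z|]; applying the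
    one-sided result to [X] and to [- X] gives equality. *)
Lemma Rintegral_mulr_eq0 (G : set (set T)) (X Z : T -> R) :
  <<s G >> `<=` @measurable d T ->
  P.-integrable setT (EFin \o X) ->
  P.-integrable setT (EFin \o (fun t => X t * Z t)) ->
  measurable_fun setT (Z : g_sigma_algebraType G -> R) ->
  (forall A, <<s G >> A -> \int[P]_(t in A) X t = 0) ->
  forall A, <<s G >> A -> \int[P]_(t in A) (X t * Z t) = 0.
Proof.
move=> sG iX iXZ mZ hX A GA; have mA := sG _ GA.
have mZT : measurable_fun setT Z.
  by move=> _ B mB; apply: sG; exact: (mZ measurableT B mB).
have mXT := integrable_real_measurable iX.
have iXaZ : P.-integrable setT (EFin \o (fun t => X t * `|Z t|)).
  apply: (@integrable_real_le _ _ _ _ _ (fun t => `|X t * Z t|)).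
  - by apply: measurable_funM => //; exact: measurableT_comp.
  - by move=> t; rewrite !normrM normr_id.
  - exact: integrable_norm.
have mX : P.-integrable setT (EFin \o (fun t => -1 * X t)) by exact: integrable_realZ.
have nX B : <<s G >> B -> \int[P]_(t in B) (-1 * X t) <= 0.
  move=> GB; rewrite RintegralZl ?hX ?mulr0//; first exact: sG.
  by apply: integrable_realS => //; exact: sG.
have key (Y : T -> R) : P.-integrable setT (EFin \o (fun t => X t * Y t)) ->
    (forall t, 0 <= Y t) -> measurable_fun setT (Y : g_sigma_algebraType G -> R) ->
    \int[P]_(t in A) (X t * Y t) = 0.
  move=> iXY Y0 mY; apply/eqP; rewrite eq_le; apply/andP; split.
    by apply: (@Rintegral_mulr_le0 _ _ _ _ G) => // B GB; rewrite hX.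
  rewrite -oppr_le0 -mulN1r -RintegralZl//; last exact: integrable_realS.
  under eq_Rintegral do rewrite mulrA.
  apply: (@Rintegral_mulr_le0 _ _ _ _ G) => //.
  by under eq_fun do rewrite -mulrA; exact: integrable_realZ.
have mN : measurable_fun setT ((fun t => `|Z t|) : g_sigma_algebraType G -> R).
  exact: measurableT_comp.
have iS := integrable_realS mA.
have -> : \int[P]_(t in A) (X t * Z t) =
    \int[P]_(t in A) (X t * (`|Z t| + Z t)) - \int[P]_(t in A) (X t * `|Z t|).
  under [X in _ = X - _]eq_Rintegral do rewrite mulrDr.
  rewrite RintegralD//; [|exact: iS|exact: iS].
  by rewrite addrAC subrr add0r.
rewrite !key ?subrr//.
- by under eq_fun do rewrite mulrDr; exact: integrable_realD.
- by move=> t; rewrite -lerBlDr sub0r -normrN ler_norm.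
- exact: measurable_funD.
Qed.

(** The maximum of [f] and [g] dominates [f] everywhere and equals [g] almost everywhere. *)
Lemma le_Rintegral_ae (A : set T) (f g : T -> R) : measurable A ->
  P.-integrable setT (EFin \o f) -> P.-integrable setT (EFin \o g) ->
  {ae P, forall t, f t <= g t} -> \int[P]_(t in A) f t <= \int[P]_(t in A) g t.
Proof.
move=> mA fi gi fg.
have mf := integrable_real_measurable fi; have mg := integrable_real_measurable gi.
have mmax : measurable_fun setT (fun t => Num.max (f t) (g t)) by exact: measurable_maxr.
have imax : P.-integrable setT (EFin \o (fun t => Num.max (f t) (g t))).
  apply: (integrable_real_le mmax (g := fun t => `|f t| + `|g t|)).
    by move=> t; rewrite /Num.max; case: ifP => _; rewrite ?lerDl ?lerDr.
  by apply: integrable_realD => //; exact: integrable_norm.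
apply: (@le_trans _ _ (\int[P]_(t in A) Num.max (f t) (g t))).
  apply: le_Rintegral => //; [exact: integrable_realS|exact: integrable_realS|].
  by move=> t _; rewrite le_max lexx.
rewrite le_eqVlt; apply/orP; left; apply/eqP; congr fine.
apply: ae_eq_integral => //.
- by apply: measurable_funTS; exact/measurable_EFinP.
- by apply: measurable_funTS; exact/measurable_EFinP.
by apply: filterS fg => t h _ /=; rewrite (max_idPr h).
Qed.

Lemma eq0_Rintegral_ae (G : set (set T)) (f : T -> R) : <<s G >> `<=` @measurable d T ->
  P.-integrable setT (EFin \o f) ->
  measurable_fun setT (f : g_sigma_algebraType G -> R) ->
  (forall A, <<s G >> A -> \int[P]_(t in A) f t = 0) ->
  {ae P, forall t, f t = 0}.
Proof.
move=> sG fi mf h.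
have mfT := integrable_real_measurable fi.
pose B := [set t | 0 <= f t].
have GB : <<s G >> B by exact: (@measurable_set_le R _ (g_sigma_algebraType G)).
have GC : <<s G >> (~` B) by exact: (@measurableC _ (g_sigma_algebraType G)).
have mB := sG _ GB; have mC := sG _ GC.
have ifn : P.-integrable setT (EFin \o (fun t => `|f t|)) by exact: integrable_norm.
have z : \int[P]_t `|f t| = 0.
  rewrite -(setUv B) Rintegral_setU//; last 2 first.
  - by rewrite setUv.
  - by apply/disj_setPS; rewrite setICr.
  rewrite (@eq_Rintegral _ _ _ _ B f) => [|t]; last by rewrite inE => /ger0_norm.
  rewrite (@eq_Rintegral _ _ _ _ (~` B) (fun t => -1 * f t)) => [|t]; last first.
    by rewrite inE /B/= => /negP; rewrite -ltNge mulN1r => /ltr0_norm.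
  by rewrite RintegralZl ?h ?mulr0 ?addr0//; exact: integrable_realS.
have z' : (\int[P]_t `|(f t)%:E| = 0)%E.
  move: z; rewrite /Rintegral => /eqP; rewrite fine_eq0; first by move=> /eqP.
  exact: integrable_fin_num.
have /ae_eq_integral_abs : measurable_fun setT (EFin \o f) by exact/measurable_EFinP.
move=> /(_ P measurableT)[/(_ z') + _].
by apply: filterS => t /(_ I) [].
Qed.

Lemma integrable_sqr_dominates (f h : T -> R) : measurable_fun setT f ->
  (forall t, `|f t| <= 1 + h t ^+ 2) ->
  P.-integrable setT (EFin \o (fun t => h t ^+ 2)) -> P.-integrable setT (EFin \o f).
Proof.
move=> mf fh ih; apply: (integrable_real_le mf fh).
by apply: integrable_realD => //; exact: integrable_real_cst.
Qed.

Lemma le_1Dsqr (a : R) : 0 <= a -> `|a| <= 1 + a ^+ 2.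
Proof. by move=> a0; rewrite ger0_norm//; nra. Qed.

Lemma probability_le_union (X Y Z : set T) :
  measurable X -> measurable Y -> measurable Z -> X `<=` Y `|` Z ->
  fine (P X) <= fine (P Y) + fine (P Z).
Proof.
move=> mX mY mZ XYZ; rewrite -lee_fin EFinD !fineK ?fin_num_measure//.
apply: le_trans (_ : P (Y `|` Z) <= _)%E.
  by rewrite le_measure ?inE//; exact: measurableU.
exact: measureU2.
Qed.

End Integral_lemmas.

(** * Recursions behind the escape from saddle points *)

Section Escape_recursions.
Context {R : realType}.

(** Adding [mu ^+ 2 * q] to [b] makes the recursion homogeneous with factor [1 + K * mu], whose
    [i]-th power is at most [expR (K * A)] as long as [i * mu <= A]. *)
Lemma perturbed_growth_le (b : nat -> R) (K A mu q : R) i :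
  0 <= K -> 0 <= mu -> 0 <= q -> b 0 <= mu ^+ 2 * q ->
  (forall i, b i.+1 <= (1 + K * mu) * b i + K * mu ^+ 3 * q) ->
  i%:R * mu <= A -> b i <= 2 * expR (K * A) * mu ^+ 2 * q.
Proof.
move=> K0 mu0 q0 b0 hb iA.
have h : b i + mu ^+ 2 * q <= (1 + K * mu) ^+ i * (2 * (mu ^+ 2 * q)).
  elim: i {iA} => [|i IH]; first by rewrite expr0; lra.
  have Kmu : 0 <= 1 + K * mu by rewrite addr_ge0// mulr_ge0.
  apply: le_trans (_ : (1 + K * mu) * (b i + mu ^+ 2 * q) <= _).
    by have := hb i; lra.
  by rewrite (exprS _ i) -[leRHS]mulrA ler_wpM2l.
have h' : (1 + K * mu) ^+ i <= expR (K * A).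
  apply: le_trans (_ : expR (K * mu) ^+ i <= _).
    by rewrite lerXn2r ?nnegrE ?expR_ge0 ?addr_ge0 ?mulr_ge0// expR_ge1Dx.
  rewrite -expRM_natl ler_expR. by rewrite mulrCA ler_wpM2l.
have m0 : 0 <= mu ^+ 2 * q by rewrite mulr_ge0 ?sqr_ge0.
have := ler_wpM2r m0 h'; lra.
Qed.

(* In the application [q] is the probability of the starting event and, in
   expectation over it, [a] is the squared linearized gradient along the unstable
   direction, [b] the fourth power of the distance to the reference point, [c] the
   value of the risk, [g] the squared gradient and [v] the squared noise along the
   unstable direction. Linear growth of [a] suffices: summed over [L] of order [1 / mu]
   steps it makes [c] lose [kappa (mu L)^2 / 8], which beats the gain [c2 mu L] once
   [mu L] is a large constant. *)
Lemma escape_recursion (a b c g v : nat -> R)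
    (mu q K B A kappa c1 c2 e1 e2 t2 s k : R) (L : nat) :
  0 <= q -> 0 < mu -> mu <= 1 -> 0 <= e1 -> 0 <= e2 -> 0 <= t2 -> 0 <= k ->
  0 <= B -> 2^-1 <= c1 ->
  (forall i, (i < L)%N -> b i <= B * mu ^+ 2 * q) ->
  0 <= a 0 ->
  (forall i, a i - mu * e1 * b i + mu ^+ 2 * t2 * v i <= a i.+1) ->
  (forall i, s * q - k * b i <= v i) ->
  (forall i, c i.+1 <= c i - mu * c1 * g i + mu ^+ 2 * c2 * q) ->
  (forall i, 0 <= g i) ->
  (forall i, 2^-1 * a i - e2 * b i <= g i) ->
  mu * (e1 * B + t2 * k * B) <= kappa -> kappa * 2 <= t2 * s ->
  8 * (c2 + 2) <= kappa * A -> mu * (kappa / 8 + e2 * B / 2) <= 1 -> 0 <= kappa ->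
  A <= L%:R * mu ->
  c L <= c 0 - mu ^+ 2 * L%:R * q.
Proof.
move=> q0 mu0 mu1 e10 e20 t20 k0 B0 c1h hb a0 ha hv hc g0 hg k1 k2 k3 k4 kap0 AL.
have m2 : 0 <= mu ^+ 2 by rewrite sqr_ge0.
(* The noise injects at least [2 * kappa * mu ^+ 2 * q] per step by [kappa * 2 <= t2 * s]; half of
   it pays for the error terms in [b]. *)
have ha' i : (i <= L)%N -> mu ^+ 2 * kappa * i%:R * q <= a i.
  elim: i => [_|i IH iL]; first by rewrite mulr0 mul0r.
  apply: le_trans (ha i).
  have {}IH := IH (ltnW iL); have {}hb := hb _ iL; have {}hv := hv i.
  rewrite -natr1.
  have h1 : mu * e1 * b i <= mu * e1 * (B * mu ^+ 2 * q) by rewrite ler_wpM2l// mulr_ge0// ltW.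
  have h2 : k * b i <= k * (B * mu ^+ 2 * q) by rewrite ler_wpM2l.
  have h3 : mu ^+ 2 * t2 * (s * q - k * (B * mu ^+ 2 * q)) <= mu ^+ 2 * t2 * v i.
    by rewrite ler_wpM2l ?mulr_ge0//; lra.
  have h4 : t2 * k * B * mu ^+ 2 <= t2 * k * B * mu.
    by rewrite ler_wpM2l ?mulr_ge0// expr2 ler_piMl// ltW.
  have h5 : 0 <= mu ^+ 2 * q by rewrite mulr_ge0.
  have h6 : mu ^+ 2 * q * kappa <= mu ^+ 2 * q * (t2 * s - mu * e1 * B - t2 * k * B * mu ^+ 2).
    by rewrite ler_wpM2l//; lra.
  by lra.
(* The term [i (i - 1) / 8] is the sum of the losses [mu / 4 * a j] over [j < i], with the linear
   lower bound on [a j] just obtained. *)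
have hc' i : (i <= L)%N -> c i <= c 0 - q * (mu ^+ 3 * kappa * (i%:R * (i%:R - 1)) / 8
    - (e2 * B / 2) * mu ^+ 3 * i%:R - mu ^+ 2 * c2 * i%:R).
  elim: i => [_|i IH iL]; first by rewrite !(mulr0, mul0r, subr0).
  have {}IH := IH (ltnW iL); have {}hb := hb _ iL; have {}ha' := ha' i (ltnW iL).
  apply: le_trans (hc i) _; rewrite -natr1.
  have h1 : mu * 2^-1 * g i <= mu * c1 * g i.
    by rewrite ler_wpM2r// ler_wpM2l// ltW.
  have h2 : mu * 2^-1 * (2^-1 * a i - e2 * b i) <= mu * 2^-1 * g i.
    by rewrite ler_wpM2l// mulr_ge0// ltW.
  have h3 : mu * 4^-1 * (mu ^+ 2 * kappa * i%:R * q) <= mu * 4^-1 * a i.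
    by rewrite ler_wpM2l// mulr_ge0// ltW.
  have h4 : mu * 2^-1 * e2 * b i <= mu * 2^-1 * e2 * (B * mu ^+ 2 * q).
    by rewrite ler_wpM2l// !mulr_ge0// ltW.
  by lra.
apply: le_trans (hc' L (leqnn L)) _; rewrite lerD2l lerN2.
set n : R := L%:R in AL *.
have n0 : 0 <= n by exact: ler0n.
have h1 : 0 <= mu ^+ 2 * n * q by exact: mulr_ge0 (mulr_ge0 m2 n0) q0.
have h2 : kappa * A <= kappa * (n * mu) by rewrite ler_wpM2l.
(* Origin of the constant in [8 * (c2 + 2) <= kappa * A]: [c2] offsets the noise gain, one unit
   offsets the lower-order terms, and one unit remains as the descent. *)
have h3 : 1 <= kappa * (n * mu - mu) / 8 - e2 * B / 2 * mu - c2 by lra.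
by have := ler_wpM2l h1 h3; lra.
Qed.

Lemma powR_le_expn4 (gamma eta : R) : 0 < gamma -> gamma <= 4 -> 0 < eta ->
  exists2 K, 0 <= K & forall a : R, 0 <= a -> a `^ gamma <= eta + K * a ^+ 4.
Proof.
move=> g0 g4 eta0; pose e := eta `^ gamma^-1.
have e0 : 0 < e by exact: powR_gt0.
have eE : e `^ gamma = eta by rewrite -powRrM mulVf ?gt_eqF// powRr1// ltW.
exists (eta / e ^+ 4); first by rewrite divr_ge0 ?exprn_ge0// ltW.
move=> a a0; have [ae|ea] := leP a e.
  apply: le_trans (_ : eta <= _).
    by rewrite -eE ge0_ler_powR ?nnegrE// ltW.
  by rewrite lerDl mulr_ge0 ?exprn_ge0// divr_ge0 ?exprn_ge0// ltW.
apply: le_trans (_ : eta / e ^+ 4 * a ^+ 4 <= _); last by rewrite lerDr ltW.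
have -> : a = e * (a / e) by rewrite mulrC divfK// gt_eqF.
have ae1 : 1 <= a / e by rewrite ler_pdivlMr// mul1r ltW.
have ae0 : 0 <= a / e by exact: le_trans ae1.
rewrite powRM ?(ltW e0)// eE exprMn [leRHS]mulrA divfK; last by rewrite gt_eqF// exprn_gt0.
rewrite ler_wpM2l ?(ltW eta0)//.
by rewrite -(powR_mulrn 4 ae0) ler_powR.
Qed.

End Escape_recursions.

(** * The stochastic gradient recursion *)

Local Arguments iterates : simpl never.

Section Stochastic_gradient.
Context {R : realType} {m : nat} {d : measure_display} {T : measurableType d}.
Context (P : probability T R) (J : 'rV[R]_m -> R).
Context (ghat : nat -> 'rV[R]_m -> T -> 'rV[R]_m) (w0 : 'rV[R]_m).
Context (Jo delta beta sigma mu : R).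
Hypotheses (delta_gt0 : 0 < delta) (beta_ge0 : 0 <= beta) (sigma_gt0 : 0 < sigma).
Hypotheses (mu_gt0 : 0 < mu) (mu_le1 : mu <= 1).
Hypothesis hgrad : lipschitz_gradient J delta.
Hypothesis hdiff : twice_differentiable J.
Hypothesis hJo : forall x, Jo <= J x.
Hypothesis hmom : noise_moments P J ghat w0 beta sigma mu.

Local Notation w := (iterates ghat mu w0).
Local Notation s := (noise_along J ghat mu w0).
Local Notation g i t := (grad J (w i t)).
Local Notation F i := (filtration w i).
Local Notation L1 f := (P.-integrable setT (EFin \o f)).
Local Notation E A f := (\int[P]_(t in A) f t).

(** The generator inside [filtration], named so that being known at time [i] becomes measurability
    for the type [Ti i]. *)
Definition coordinate_events i : set (set T) :=
  [set A | exists (j : nat) (k : 'I_m) (B : set R),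
     [/\ (j <= i)%N, measurable B & A = [set t | B (w j t 0 k)]]].

Local Notation Ti i := (g_sigma_algebraType (coordinate_events i)).

(** * Measurability and integrability along the trajectory *)

Lemma iterates_step i t : w i.+1 t = w i t - mu *: (g i t + s i t).
Proof.
rewrite -[LHS]/(w i t - mu *: ghat i.+1 (w i t) t); congr (_ - _ *: _).
by rewrite /noise_along /gradient_noise [RHS]addrC subrK.
Qed.

Lemma integrable_noise_coord i k : L1 (fun t => s i t 0 k).
Proof. by have [/(_ k) []] := hmom i. Qed.

Lemma measurable_noise_coord i k : measurable_fun setT (fun t => s i t 0 k).
Proof. exact/integrable_real_measurable/integrable_noise_coord. Qed.

(** Measurability of the noise along the trajectory comes with its integrability in [noise_moments];
    continuity of the gradient carries it to the next iterate. *)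
Lemma measurable_iterates i k : measurable_fun setT (fun t => w i t 0 k).
Proof.
elim: i k => [|i IH] k; first exact: measurable_cst.
have -> : (fun t => w i.+1 t 0 k) = (fun t => w i t 0 k - mu * (g i t 0 k + s i t 0 k)).
  apply/funext => t; rewrite iterates_step.
  by move: (g i t) (s i t) => a b; rewrite !mxE.
apply: measurable_funB => //; apply: measurable_funM => //.
apply: measurable_funD; last exact: measurable_noise_coord.
apply: (measurable_continuous_comp (f := fun x => grad J x 0 k)) => //.
by apply: grad_coord_continuous; case: hdiff.
Qed.

Lemma filtration_measurable i : F i `<=` @measurable d T.
Proof.
apply: smallest_sub; first exact: sigma_algebra_measurable.
move=> _ [j [k [B [_ mB ->]]]].
rewrite -[X in measurable X]setTI; exact: measurable_iterates.
Qed.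

Lemma filtration_mono i j : (i <= j)%N -> F i `<=` F j.
Proof.
move=> ij; apply: sub_sigma_algebra2 => _ [k [l [B [ki mB ->]]]].
by exists k, l, B; split => //; exact: leq_trans ij.
Qed.

Lemma adapted_iterates i j k : (j <= i)%N ->
  measurable_fun setT ((fun t => w j t 0 k) : Ti i -> R).
Proof.
move=> ji _ B mB; rewrite setTI; apply: sub_sigma_algebra.
by exists j, k, B.
Qed.

Lemma adapted_grad i k :
  measurable_fun setT ((fun t => g i t 0 k) : Ti i -> R).
Proof.
apply: (@measurable_continuous_comp _ _ (Ti i) _ _ (fun x => grad J x 0 k)) => [l|].
  exact: adapted_iterates.
by apply: grad_coord_continuous; case: hdiff.
Qed.

Lemma adapted_dist i x k :
  measurable_fun setT ((fun t => (w i t - x) 0 k) : Ti i -> R).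
Proof.
under eq_fun do rewrite !mxE.
by apply: measurable_funB => //; exact: adapted_iterates.
Qed.

Lemma adapted_measurable i (f : T -> R) :
  measurable_fun setT (f : Ti i -> R) -> measurable_fun setT f.
Proof.
by move=> mf _ B mB; apply: (@filtration_measurable i); exact: (mf measurableT B mB).
Qed.

Lemma grad_sq_le x y : dotv (grad J y) (grad J y) ^+ 2 <=
  8 * (delta ^+ 4 * dotv (y - x) (y - x) ^+ 2 + dotv (grad J x) (grad J x) ^+ 2).
Proof.
have := dotvD_sq_le (grad J y - grad J x) (grad J x); rewrite subrK => h.
apply: le_trans h _; rewrite ler_wpM2l// lerD2r.
have l := hgrad y x.
have : enorm (grad J y - grad J x) ^+ 4 <= (delta * enorm (y - x)) ^+ 4.
  by rewrite lerXn2r// nnegrE ?enorm_ge0 ?mulr_ge0 ?enorm_ge0 ?ltW.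
by rewrite exprMn !(exprM _ 2 2) !sqr_enorm.
Qed.

Lemma integrable_noise4 i : L1 (fun t => dotv (s i t) (s i t) ^+ 2).
Proof.
have [_ [Y [[h _ _ _] _]]] := hmom i.
by under eq_fun do rewrite -sqr_enorm -exprM.
Qed.

Lemma dist_step_le x i t :
  dotv (w i.+1 t - x) (w i.+1 t - x) ^+ 2 <=
  8 * dotv (w i t - x) (w i t - x) ^+ 2 +
  64 * dotv (g i t) (g i t) ^+ 2 + 64 * dotv (s i t) (s i t) ^+ 2.
Proof.
rewrite iterates_step addrAC.
have h1 := dotvD_sq_le (w i t - x) (- (mu *: (g i t + s i t))).
have h2 := dotvD_sq_le (g i t) (s i t).
apply: le_trans h1 _; rewrite mulrDr -addrA lerD2l.
rewrite dotvNl dotvNr opprK dotvZl dotvZr mulrA exprMn.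
have m1 : (mu * mu) ^+ 2 <= 1 .
  have mu0 := ltW mu_gt0.
  by apply: exprn_ile1; [exact: mulr_ge0 | exact: mulr_ile1].
have := ler_wpM2r (sqr_ge0 (dotv (g i t + s i t) (g i t + s i t))) m1.
by move: h2; move: (dotv _ _ ^+ 2) (dotv (g i t) _ ^+ 2) (dotv (s i t) _ ^+ 2) => a b c h; lra.
Qed.

Lemma integrable_dist4 x i : L1 (fun t => dotv (w i t - x) (w i t - x) ^+ 2).
Proof.
elim: i x => [|i IH] x.
  exact: (@integrable_real_cst _ _ _ P setT (dotv (w0 - x) (w0 - x) ^+ 2)).
have mm : measurable_fun setT (fun t => dotv (w i.+1 t - x) (w i.+1 t - x) ^+ 2).
  apply: measurable_funX; apply: measurable_dotv => k;
    by apply: (@adapted_measurable i.+1); exact: adapted_dist.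
apply: (integrable_real_le mm (g := fun t =>
  (8 + 512 * delta ^+ 4) * dotv (w i t - x) (w i t - x) ^+ 2 +
  64 * dotv (s i t) (s i t) ^+ 2 + 512 * dotv (grad J x) (grad J x) ^+ 2)).
  move=> t; rewrite ger0_norm ?sqr_ge0//.
  apply: le_trans (dist_step_le x i t) _.
  by have := grad_sq_le x (w i t); lra.
apply: integrable_realD => //; last exact: integrable_real_cst.
apply: integrable_realD => //; apply: integrable_realZ => //.
exact: integrable_noise4.
Qed.

Lemma integrable_grad4 i : L1 (fun t => dotv (g i t) (g i t) ^+ 2).
Proof.
apply: (integrable_real_le (g := fun t =>
  8 * delta ^+ 4 * dotv (w i t - w0) (w i t - w0) ^+ 2 +
  8 * dotv (grad J w0) (grad J w0) ^+ 2)).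
- apply: measurable_funX; apply: measurable_dotv => k;
    by apply: (@adapted_measurable i); exact: adapted_grad.
- by move=> t; rewrite ger0_norm ?sqr_ge0//; have := grad_sq_le w0 (w i t); lra.
apply: integrable_realD => //; last exact: integrable_real_cst.
by apply: integrable_realZ => //; exact: integrable_dist4.
Qed.

Lemma integrable_grad2 i : L1 (fun t => dotv (g i t) (g i t)).
Proof.
apply: (integrable_sqr_dominates (h := fun t => dotv (g i t) (g i t))).
- by apply: measurable_dotv => k; apply: (@adapted_measurable i); exact: adapted_grad.
- by move=> t; apply: le_1Dsqr; exact: dotvv_ge0.
- exact: integrable_grad4.
Qed.

Lemma integrable_noise2 i : L1 (fun t => dotv (s i t) (s i t)).
Proof.
apply: (integrable_sqr_dominates (h := fun t => dotv (s i t) (s i t))).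
- by apply: measurable_dotv => k; exact: measurable_noise_coord.
- by move=> t; apply: le_1Dsqr; exact: dotvv_ge0.
- exact: integrable_noise4.
Qed.

Lemma measurable_value i : measurable_fun setT ((fun t => J (w i t)) : Ti i -> R).
Proof.
apply: (@measurable_continuous_comp _ _ (Ti i)) => [k|x]; first exact: adapted_iterates.
by apply: differentiable_continuous; case: hdiff.
Qed.

(** The risk lies between [Jo] and the quadratic upper model at [w0], so second moments of the
    distance suffice. *)
Lemma integrable_value i : L1 (fun t => J (w i t)).
Proof.
have dJ := hdiff.1.
pose c := `|Jo| + `|J w0| + dotv (grad J w0) (grad J w0) + 1 + delta.
apply: (integrable_real_le (g := fun t => c + (1 + delta) * dotv (w i t - w0) (w i t - w0) ^+ 2)).
- by apply: (@adapted_measurable i); exact: measurable_value.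
- move=> t; set u := w i t - w0.
  have e : w i t = w0 + u by rewrite addrC subrK.
  clearbody u.
  have := lipschitz_gradient_descent w0 u dJ hgrad; rewrite -e => h1.
  have h2 : dotv (grad J w0) u <= dotv (grad J w0) (grad J w0) + dotv u u.
    have := dotvv_ge0 (grad J w0 - u); have := dotvv_ge0 (grad J w0); have := dotvv_ge0 u.
    by rewrite !(dotvBl, dotvBr) (dotvC u (grad J w0)); lra.
  have u0 := dotvv_ge0 u; have g0 := dotvv_ge0 (grad J w0).
  have u1 : dotv u u <= 1 + dotv u u ^+ 2 by have := le_1Dsqr u0; rewrite ger0_norm.
  have u2 := sqr_ge0 (dotv u u).
  have Jl := hJo (w i t).
  have n1 := ler_norm (- Jo); rewrite normrN in n1.
  have n2 := ler_norm (J w0); have n3 := normr_ge0 (J w0); have n4 := normr_ge0 Jo.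
  move: h1 h2 u0 g0 u1 u2 Jl n1 n2 n3 n4; rewrite /c.
  move: (dotv (grad J w0) u) (dotv u u) (dotv (grad J w0) (grad J w0)).
  move: (J (w i t)) (J w0) => f h a b e'.
  move=> h1 h2 b0 e0 b1 b2 Jl n1 n2 n3 n4.
  have h3 : delta * b <= delta * (1 + b ^+ 2) by rewrite ler_wpM2l// ltW.
  have h4 : 0 <= delta * b by rewrite mulr_ge0// ltW.
  by rewrite ler_norml; lra.
apply: integrable_realD => //; first exact: integrable_real_cst.
by apply: integrable_realZ => //; exact: integrable_dist4.
Qed.

(** * Noise moments on known events and descent of the expected risk *)

Lemma noise4_le i (A : set T) : F i A ->
  E A (fun t => dotv (s i t) (s i t) ^+ 2) <=
  E A (fun t => beta ^+ 4 * dotv (g i t) (g i t) ^+ 2 + sigma ^+ 4).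
Proof.
move=> FA; have mA := filtration_measurable FA.
have [_ [Y [[h1 h2 _ h4] Yle]]] := hmom i.
have -> : E A (fun t => dotv (s i t) (s i t) ^+ 2) = E A Y.
  rewrite /Rintegral -h4//; congr fine; apply: eq_integral => t _.
  by rewrite -sqr_enorm -exprM.
apply: le_Rintegral_ae => //.
  apply: integrable_realD => //; last exact: integrable_real_cst.
  by apply: integrable_realZ => //; exact: integrable_grad4.
by apply: filterS Yle => t h; rewrite -sqr_enorm -exprM.
Qed.

(** A conditional Jensen inequality in tangent form. With [q] the claimed conditional bound,
    [|s|^2 <= q + X / (2 q)], where [X] is the excess of [|s|^4] over its own bound; the weight
    [1 / q] is known at time [i] and nonnegative, so the term in [X] integrates to at most 0.
    Positivity of [sigma] keeps this weight bounded. *)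
Lemma noise2_le i (A : set T) : F i A ->
  E A (fun t => dotv (s i t) (s i t)) <=
  beta ^+ 2 * E A (fun t => dotv (g i t) (g i t)) + sigma ^+ 2 * fine (P A).
Proof.
move=> FA; have mA := filtration_measurable FA.
have s0 : 0 < sigma ^+ 2 by rewrite exprn_gt0.
pose q t := beta ^+ 2 * dotv (g i t) (g i t) + sigma ^+ 2.
have qs t : sigma ^+ 2 <= q t by rewrite lerDr mulr_ge0 ?sqr_ge0 ?dotvv_ge0.
have q0 t : 0 < q t by exact: lt_le_trans (qs t).
pose X t := dotv (s i t) (s i t) ^+ 2 - (beta ^+ 4 * dotv (g i t) (g i t) ^+ 2 + sigma ^+ 4).
have iB : L1 (fun t => beta ^+ 4 * dotv (g i t) (g i t) ^+ 2 + sigma ^+ 4).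
  apply: integrable_realD => //; last exact: integrable_real_cst.
  by apply: integrable_realZ => //; exact: integrable_grad4.
have iX : L1 X by apply: integrable_realB => //; exact: integrable_noise4.
have iq : L1 q.
  apply: integrable_realD => //; last exact: integrable_real_cst.
  by apply: integrable_realZ => //; exact: integrable_grad2.
have mq : measurable_fun setT (q : Ti i -> R).
  apply: measurable_funD => //; apply: measurable_funM => //.
  by apply: measurable_dotv => k; exact: adapted_grad.
have mqV : measurable_fun setT ((fun t => (q t)^-1) : Ti i -> R).
  have -> : (fun t => (q t)^-1) = (fun t => expR (- ln (q t))).
    by apply/funext => t; rewrite expRN lnK ?posrE.
  apply: measurableT_comp; first exact: measurable_expR.
  by apply: measurable_funN; apply: measurableT_comp => //; exact: measurable_ln.
have iXq : L1 (fun t => X t * (q t)^-1).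
  apply: (integrable_real_le (g := fun t => (sigma ^+ 2)^-1 * `|X t|)).
  - apply: measurable_funM; first exact: integrable_real_measurable iX.
    exact: (@adapted_measurable i).
  - move=> t; rewrite normrM mulrC ler_wpM2r// gtr0_norm ?invr_gt0//.
    by rewrite lef_pV2 ?posrE.
  - by apply: integrable_realZ => //; exact: integrable_norm.
have h : E A (fun t => X t * (q t)^-1) <= 0.
  apply: (@Rintegral_mulr_le0 _ _ _ P (coordinate_events i)) => //.
  - exact: filtration_measurable.
  - by move=> t; rewrite invr_ge0 ltW.
  move=> B FB; have mB := filtration_measurable FB.
  rewrite /X RintegralB// ?subr_le0; [exact: noise4_le| |];
    apply: integrable_realS => //; exact: integrable_noise4.
have := @Rintegral_le_lincomb _ _ _ P A (fun t => dotv (s i t) (s i t))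
  [:: (2^-1, fun t => X t * (q t)^-1);
      (beta ^+ 2, fun t => dotv (g i t) (g i t)); (sigma ^+ 2, fun=> 1)] mA.
rewrite !big_cons !big_nil/= Rintegral_cst// mul1r => H.
apply: le_trans (H _ _ _) _.
- exact: integrable_noise2.
- by do !split => //; [exact: integrable_grad2|exact: integrable_real_cst].
- move=> t; rewrite !big_cons !big_nil/= addr0 mulr1.
  change (dotv (s i t) (s i t) <= 2^-1 * (X t / q t) + q t).
  have e : X t + (q t) ^+ 2 >= dotv (s i t) (s i t) ^+ 2.
    rewrite /X /q; have := dotvv_ge0 (g i t); move: (dotv (g i t) _) (dotv (s i t) _) => a b a0.
    have -> : (beta ^+ 2 * a + sigma ^+ 2) ^+ 2 =
        beta ^+ 4 * a ^+ 2 + sigma ^+ 4 + 2 * (beta ^+ 2 * a * sigma ^+ 2) by ring.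
    have : 0 <= beta ^+ 2 * a * sigma ^+ 2.
      by apply: mulr_ge0 (sqr_ge0 _); exact: mulr_ge0 (sqr_ge0 _) a0.
    by lra.
  have := dotvv_ge0 (s i t); move: (dotv (s i t) _) e (q0 t) => b e qp b0.
  rewrite -(ler_pM2r (_ : 0 < 2 * q t)) ?mulr_gt0//.
  have -> : (2^-1 * (X t / q t) + q t) * (2 * q t) = X t + 2 * q t ^+ 2.
    by field; rewrite gt_eqF.
  by have := sqr_ge0 (b - q t); nra.
by lra.
Qed.

(** The martingale difference property, applied coordinate by coordinate; [D] supplies integrability
    of the products. *)
Lemma dot_noise_eq0 i (xi : T -> 'rV[R]_m) (D : T -> R) (A : set T) :
  (forall k, measurable_fun setT ((fun t => xi t 0 k) : Ti i -> R)) ->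
  (forall k t, `|s i t 0 k * xi t 0 k| <= D t) -> L1 D -> F i A ->
  L1 (fun t => dotv (s i t) (xi t)) /\ E A (fun t => dotv (s i t) (xi t)) = 0.
Proof.
move=> mxi xiD iD FA; have mA := filtration_measurable FA.
have ik k : L1 (fun t => s i t 0 k * xi t 0 k).
  apply: (integrable_real_le _ (xiD k)) => //.
  apply: measurable_funM; first exact: measurable_noise_coord.
  exact: (@adapted_measurable i).
split; first exact: integrable_real_sum.
rewrite /dotv Rintegral_sum//.
apply: big1_seq => k _; apply: (@Rintegral_mulr_eq0 _ _ _ P (coordinate_events i)) => //.
- exact: filtration_measurable.
- exact: integrable_noise_coord.
move=> B FB; have [/(_ k)[_ _ _ h] _] := hmom i.
by rewrite /Rintegral h// integral0.
Qed.

Lemma value_step_le i (A : set T) : F i A ->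
  E A (fun t => J (w i.+1 t)) <= E A (fun t => J (w i t))
    - mu * c1 delta beta mu * E A (fun t => dotv (g i t) (g i t))
    + mu ^+ 2 * c2 delta sigma * fine (P A).
Proof.
move=> FA; have mA := filtration_measurable FA.
have [i0 e0] : L1 (fun t => dotv (s i t) (g i t)) /\ E A (fun t => dotv (s i t) (g i t)) = 0.
  apply: (@dot_noise_eq0 _ _ (fun t => dotv (s i t) (s i t) + dotv (g i t) (g i t))) => //.
  - by move=> k; exact: adapted_grad.
  - by move=> k t; exact: normr_coordM_le_dotv.
  - by apply: integrable_realD => //; [exact: integrable_noise2|exact: integrable_grad2].
have := @Rintegral_le_lincomb _ _ _ P A (fun t => J (w i.+1 t))
  [:: (1, fun t => J (w i t)); (- mu + mu ^+ 2 * (delta / 2), fun t => dotv (g i t) (g i t));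
      (- mu + mu ^+ 2 * delta, fun t => dotv (s i t) (g i t));
      (mu ^+ 2 * (delta / 2), fun t => dotv (s i t) (s i t))] mA.
rewrite !big_cons !big_nil/= e0 => H.
apply: le_trans (H _ _ _) _ => {H}.
- exact: integrable_value.
- by do !split => //; [exact: integrable_value|exact: integrable_grad2|exact: integrable_noise2].
- move=> t; rewrite !big_cons !big_nil/= iterates_step.
  move: (s i t) (w i t) => b x.
  have := lipschitz_gradient_descent x (- (mu *: (grad J x + b))) hdiff.1 hgrad.
  move=> /le_trans; apply; rewrite le_eqVlt; apply/orP; left; apply/eqP.
  rewrite !(dotvNl, dotvNr, dotvZl, dotvZr, dotvDl, dotvDr) (dotvC (grad J x) b).
  by field.
have h := noise2_le FA.
have m2 : 0 <= mu ^+ 2 * (delta / 2) by rewrite mulr_ge0 ?sqr_ge0// divr_ge0// ltW.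
have := ler_wpM2l m2 h; rewrite /c1 /c2.
by lra.
Qed.

(** * Fourth moment of the distance to a reference point *)

Lemma integrable_dist2 x i : L1 (fun t => dotv (w i t - x) (w i t - x)).
Proof.
apply: (integrable_sqr_dominates (h := fun t => dotv (w i t - x) (w i t - x))).
- by apply: measurable_dotv => k; apply: (@adapted_measurable i); exact: adapted_dist.
- by move=> t; apply: le_1Dsqr; exact: dotvv_ge0.
- exact: integrable_dist4.
Qed.

(* The growth rate of [E|w i - x|^4] per unit of [mu], when [|grad J x|^2 <= Cg mu]. *)
Definition dist4_rate (Cg : R) : R :=
  8 + (4 + 56 * (1 + beta ^+ 4)) * 8 * (delta ^+ 4 + Cg ^+ 2) + 56 * sigma ^+ 4.

(** The only noise term of first order in [mu] is [- 4 mu |u|^2 <u, s>] with [u = w i - x], and it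
    integrates to zero. What remains of the noise carries [mu ^+ 3], so that 1/mu steps accumulate
    only order [mu ^+ 2]. *)
Lemma dist4_step_le x Cg i (A : set T) : F i A -> 0 <= Cg ->
  dotv (grad J x) (grad J x) <= Cg * mu ->
  E A (fun t => dotv (w i.+1 t - x) (w i.+1 t - x) ^+ 2) <=
  (1 + dist4_rate Cg * mu) * E A (fun t => dotv (w i t - x) (w i t - x) ^+ 2)
    + dist4_rate Cg * mu ^+ 3 * fine (P A).
Proof.
move=> FA Cg0 gx; have mA := filtration_measurable FA.
pose U t := dotv (w i t - x) (w i t - x).
have [i0 e0] : L1 (fun t => dotv (s i t) (U t *: (w i t - x))) /\
    E A (fun t => dotv (s i t) (U t *: (w i t - x))) = 0.
  apply: (@dot_noise_eq0 _ _ (fun t => dotv (s i t) (s i t) ^+ 2 + U t ^+ 2)) => //.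
  - move=> k; under eq_fun do rewrite mxE.
    apply: measurable_funM; last exact: adapted_dist.
    by apply: measurable_dotv => l; exact: adapted_dist.
  - move=> k t; have -> : (U t *: (w i t - x)) 0 k = U t * (w i t - x) 0 k by rewrite mxE.
    rewrite mulrCA (normrM (U t)) ger0_norm ?dotvv_ge0// /U.
    have := normr_coordM_le (s i t) (w i t - x) k; rewrite -!sqr_enorm.
    have := enorm_ge0 (s i t); have := enorm_ge0 (w i t - x).
    move: `|_| (enorm (s i t)) (enorm (w i t - x)) => a c b b0 c0 h.
    apply: le_trans (ler_wpM2l (sqr_ge0 b) h) _.
    rewrite -!exprM mulrCA -exprSr.
    have [bc|cb] := leP b c.
      apply: le_trans (_ : c ^+ 4 <= _); last by rewrite lerDl exprn_ge0.
      by rewrite [leRHS]exprS ler_wpM2l// lerXn2r.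
    apply: le_trans (_ : b ^+ 4 <= _); last by rewrite lerDr exprn_ge0.
    by rewrite [leRHS]exprS ler_wpM2r ?exprn_ge0// ltW.
  - by apply: integrable_realD => //; [exact: integrable_noise4|exact: integrable_dist4].
(* The mixed terms add up to [8 mu^2 U H], with [H = |g + s|^2], and are split into
   [4 mu U^2 + 4 mu^3 H^2]; another [3 mu^4 H^2] makes [7 mu^3 H^2]. Since [H^2] is at most 8 times
   the sum of the squares of [|g|^2] and [|s|^2], the coefficient is 56. *)
have := @Rintegral_le_lincomb _ _ _ P A (fun t => dotv (w i.+1 t - x) (w i.+1 t - x) ^+ 2)
  [:: (1 + 8 * mu, fun t => U t ^+ 2); (4 * mu + 56 * mu ^+ 3, fun t => dotv (g i t) (g i t) ^+ 2);
      (56 * mu ^+ 3, fun t => dotv (s i t) (s i t) ^+ 2);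
      (- 4 * mu, fun t => dotv (s i t) (U t *: (w i t - x)))] mA.
rewrite !big_cons !big_nil/= e0 => H.
apply: le_trans (H _ _ _) _ => {H}.
- exact: integrable_dist4.
- by do !split => //; [exact: integrable_dist4|exact: integrable_grad4|exact: integrable_noise4].
- move=> t; rewrite !big_cons !big_nil/= iterates_step /U addrAC.
  move: (s i t) (g i t) (w i t - x) => a b u.
  have CS := dotv_CS_sqr u (b + a).
  have CS' := dotv_CS_sqr u b.
  have h8 := dotvD_sq_le b a.
  rewrite !(dotvBl, dotvBr) !(dotvZl, dotvZr) (dotvC (b + a) u).
  have -> : dotv a u = dotv u (b + a) - dotv u b by rewrite dotvDr (dotvC a); ring.
  move: (dotvv_ge0 u) (dotvv_ge0 b) CS CS' h8.
  move: (dotv u u) (dotv b b) (dotv a a) (dotv u b) (dotv u (b + a)) (dotv (b + a) (b + a)).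
  move=> U' G S p r H U0 G0 CS CS' h8.
  have m2 : 0 <= mu ^+ 2 by rewrite sqr_ge0.
  have m3 : 0 <= mu ^+ 3 by rewrite exprn_ge0// ltW.
  have m43 : mu ^+ 4 <= mu ^+ 3 by rewrite exprS ler_piMl.
  have q1 : mu ^+ 2 * r ^+ 2 <= mu ^+ 2 * (U' * H) by rewrite ler_wpM2l.
  have q2 : 0 <= (mu * r + mu ^+ 2 * H) ^+ 2 by rewrite sqr_ge0.
  have q3 : 0 <= mu * (U' - mu * H) ^+ 2 by rewrite mulr_ge0 ?sqr_ge0// ltW.
  have q4 : mu ^+ 4 * H ^+ 2 <= mu ^+ 3 * H ^+ 2 by rewrite ler_wpM2r ?sqr_ge0.
  have q5 : mu ^+ 3 * H ^+ 2 <= mu ^+ 3 * (8 * (G ^+ 2 + S ^+ 2)).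
    by rewrite ler_wpM2l.
  have q6 : - (U' * p) <= U' ^+ 2 + G ^+ 2.
    have h : p ^+ 2 <= ((U' + G) / 2) ^+ 2.
      by apply: le_trans CS' _; have := sqr_ge0 (U' - G); nra.
    rewrite -ler_sqrt ?sqr_ge0// !sqrtr_sqr in h.
    rewrite (ger0_norm (_ : 0 <= (U' + G) / 2)) in h; last by rewrite divr_ge0 ?addr_ge0.
    have h' : - p <= (U' + G) / 2 by rewrite (le_trans _ h)// -normrN ler_norm.
    have := ler_wpM2l U0 h'; have := sqr_ge0 (U' - G); have := sqr_ge0 G; have := sqr_ge0 U'.
    by lra.
  have q7 : mu * - (U' * p) <= mu * (U' ^+ 2 + G ^+ 2) by rewrite ler_wpM2l// ltW.
  by nra.
have hs : E A (fun t => dotv (s i t) (s i t) ^+ 2) <=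
    beta ^+ 4 * E A (fun t => dotv (g i t) (g i t) ^+ 2) + sigma ^+ 4 * fine (P A).
  apply: le_trans (noise4_le FA) _.
  rewrite RintegralD ?Rintegral_cst ?RintegralZl//; apply: integrable_realS => //.
  - exact: integrable_grad4.
  - by apply: integrable_realZ => //; exact: integrable_grad4.
  - exact: integrable_real_cst.
(* The gradient is compared with its value at [x], whose fourth power is of order [mu ^+ 2]; with
   the prefactor [mu] this matches the [mu ^+ 3] of the noise. *)
have hg : E A (fun t => dotv (g i t) (g i t) ^+ 2) <=
    8 * (delta ^+ 4 * E A (fun t => U t ^+ 2) + Cg ^+ 2 * mu ^+ 2 * fine (P A)).
  have := @Rintegral_le_lincomb _ _ _ P A (fun t => dotv (g i t) (g i t) ^+ 2)
    [:: (8 * delta ^+ 4, fun t => U t ^+ 2); (8 * (Cg ^+ 2 * mu ^+ 2), fun=> 1)] mA.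
  rewrite !big_cons !big_nil/= Rintegral_cst// => H.
  apply: le_trans (H _ _ _) _ => {H}.
  - exact: integrable_grad4.
  - by do !split => //; [exact: integrable_dist4|exact: integrable_real_cst].
  - move=> t; rewrite !big_cons !big_nil/=.
    apply: le_trans (grad_sq_le x (w i t)) _; rewrite -/(U t).
    have : dotv (grad J x) (grad J x) ^+ 2 <= (Cg * mu) ^+ 2.
      by rewrite lerXn2r ?nnegrE ?dotvv_ge0// mulr_ge0// ltW.
    by rewrite exprMn; lra.
  by lra.
have b0 : 0 <= E A (fun t => U t ^+ 2) by apply: Rintegral_ge0 => t _; exact: sqr_ge0.
have q0 : 0 <= fine (P A) by exact: fine_ge0.
have m3 : 0 <= mu ^+ 3 by rewrite exprn_ge0// ltW.
have m31 : mu ^+ 3 <= mu by rewrite exprS ler_piMr ?exprn_ile1// ltW.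
have gg0 : 0 <= E A (fun t => dotv (g i t) (g i t) ^+ 2).
  by apply: Rintegral_ge0 => t _; exact: sqr_ge0.
rewrite /dist4_rate; rewrite /U in b0 hg *.
move: b0 q0 gg0 hs hg.
move: (E A (fun t => dotv (w i t - x) _ ^+ 2)) (E A (fun t => dotv (g i t) _ ^+ 2)).
move: (E A (fun t => dotv (s i t) _ ^+ 2)) (fine _) => ss q b gg b0 q0 gg0 hs hg.
have : 0 <= beta ^+ 4 by rewrite exprn_ge0.
have : 0 <= delta ^+ 4 by rewrite exprn_ge0// ltW.
have : 0 <= sigma ^+ 4 by rewrite exprn_ge0// ltW.
have : 0 <= Cg ^+ 2 by rewrite sqr_ge0.
move: hs hg; move: (beta ^+ 4) (delta ^+ 4) (sigma ^+ 4) (Cg ^+ 2) => B D S C hs hg C0 S0 D0 B0.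
pose c := 4 + 56 * (1 + B).
have c0 : 0 <= c by rewrite /c; lra.
have mu0 := ltW mu_gt0.
have k1 := ler_wpM2l m3 hs.
have k2 : mu ^+ 3 * ((1 + B) * gg) <= mu * ((1 + B) * gg).
  by rewrite ler_wpM2r// mulr_ge0// addr_ge0.
have k3 := ler_wpM2l (mulr_ge0 mu0 c0) hg.
have k4 : 0 <= mu * b * (c * C) by rewrite !mulr_ge0.
have k5 : 0 <= mu * b * S by rewrite !mulr_ge0.
have k6 : 0 <= mu ^+ 3 * q * (c * D) by rewrite !mulr_ge0.
have k7 : 0 <= mu ^+ 3 * q by rewrite !mulr_ge0.
have -> : 4 + 56 * (1 + B) = c by [].
have k8 : mu * c * gg = 4 * (mu * gg) + 56 * (mu * ((1 + B) * gg)) by rewrite /c; ring.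
by lra.
Qed.

Lemma noise_direction_covariance Rs i (A : set T) (v : 'rV[R]_m) :
  noise_covariance P J ghat w0 Rs mu -> F i A ->
  [/\ L1 (fun t => dotv v (s i t) ^+ 2), L1 (fun t => dotv v (v *m Rs (w i t))) &
  E A (fun t => dotv v (s i t) ^+ 2) = E A (fun t => dotv v (v *m Rs (w i t)))].
Proof.
move=> hcov FA; have mA := filtration_measurable FA.
have e : (fun t => dotv v (s i t) ^+ 2) = (fun t => dotv v (v *m ((s i t)^T *m s i t))).
  apply/funext => t; move: (s i t) => b.
  rewrite mulmxA (_ : v *m b^T = (dotv v b)%:M); last first.
    by apply/matrixP => k l; rewrite (ord1 k) (ord1 l) dotv_mulmx !mxE mulr1n.
  by rewrite mul_scalar_mx dotvZr expr2.
have i1 k l : L1 (fun t => ((s i t)^T *m s i t) k l) by have [] := hcov i k l.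
have i2 k l : L1 (fun t => Rs (w i t) k l) by have [] := hcov i k l.
have [h1 e1] := Rintegral_quadratic_form v mA i1.
have [h2 e2] := Rintegral_quadratic_form v mA i2.
split; rewrite ?e// e1 e2; apply: eq_bigr => k _; apply: eq_bigr => l _.
by congr (_ * _); have [_ _ _ h] := hcov i l k; rewrite /Rintegral h.
Qed.

(** Hoelder continuity carries the variance at [x] over to the iterates; the loss is a fixed
    fraction [eta] plus a multiple of the fourth moment, which is small. *)
Lemma noise_direction_ge Rs betaR gamma eta K x i (A : set T) (v : 'rV[R]_m) :
  noise_covariance P J ghat w0 Rs mu -> hoelder_covariance Rs betaR gamma ->
  (forall a, 0 <= a -> a `^ gamma <= eta + K * a ^+ 4) ->
  dotv v v = 1 -> F i A ->
  (dotv v (v *m Rs x) - `|betaR| * eta) * fine (P A)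
    - `|betaR| * K * E A (fun t => dotv (w i t - x) (w i t - x) ^+ 2)
  <= E A (fun t => dotv v (s i t) ^+ 2).
Proof.
move=> hcov hol hK v1 FA; have mA := filtration_measurable FA.
have [_ i2 ->] := noise_direction_covariance v hcov FA.
have := @Rintegral_ge_lincomb _ _ _ P A (fun t => dotv v (v *m Rs (w i t)))
  [:: (dotv v (v *m Rs x) - `|betaR| * eta, fun=> 1);
      (- (`|betaR| * K), fun t => dotv (w i t - x) (w i t - x) ^+ 2)] mA i2.
rewrite !big_cons !big_nil/= Rintegral_cst// => H.
apply: le_trans (H _ _); first by rewrite addr0 mul1r mulNr.
- by do !split => //; [exact: integrable_real_cst|exact: integrable_dist4].
- move=> t; rewrite !big_cons !big_nil/= addr0 mulr1 mulNr.
  have ev : enorm v = 1 by rewrite enormE v1 sqrtr1.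
  have h : `|dotv v (v *m Rs (w i t)) - dotv v (v *m Rs x)| <=
      `|betaR| * (eta + K * enorm (w i t - x) ^+ 4).
    rewrite -dotvBr -mulmxBr (le_trans (dotv_CS _ _))// ev mul1r.
    rewrite (le_trans (enorm_mulmx_le_specnorm _ _))// ev mulr1.
    rewrite (le_trans (hol _ _))//.
    apply: le_trans (ler_wpM2r (powR_ge0 _ _) (ler_norm _)) _.
    by rewrite ler_wpM2l// hK// enorm_ge0.
  rewrite -sqr_enorm -exprM.
  by have := ler_norm (- (dotv v (v *m Rs (w i t)) - dotv v (v *m Rs x))); rewrite normrN; lra.
Qed.

(** * Growth of the gradient along an unstable direction *)

Section Unstable_direction.
Context (rho tau l : R) (x v : 'rV[R]_m).
Hypotheses (rho_ge0 : 0 <= rho) (hhess : lipschitz_hessian J rho).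
Hypotheses (tau_ge0 : 0 <= tau) (tau_le : tau <= l) (l_le : l <= delta) (v1 : dotv v v = 1).
Hypothesis hv : forall u, dotv v (u *m hess J x) = - l * dotv v u.

(* The component along [v] of the gradient of the quadratic model of [J] at [x]. *)
Let z i t := dotv v (grad J x) - l * dotv v (w i t - x).

Let enorm_v : enorm v = 1. Proof. by rewrite enormE v1 sqrtr1. Qed.

Let linearization i t : (dotv v (g i t) - z i t) ^+ 2 <=
  rho ^+ 2 * dotv (w i t - x) (w i t - x) ^+ 2.
Proof.
have := @grad_taylor _ _ J rho x (w i t - x) v hdiff hhess rho_ge0.
rewrite enorm_v => /(_ (lexx _)).
have -> : x + (w i t - x) = w i t by rewrite addrC subrK.
rewrite dotvDr hv mulNr -/(z i t) => h.
rewrite -exprMn -[leLHS]real_normK ?num_real// lerXn2r// nnegrE//.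
by rewrite mulr_ge0 ?dotvv_ge0.
Qed.

Let measurable_z i : measurable_fun setT (z i : Ti i -> R).
Proof.
apply: measurable_funB => //; apply: measurable_funM => //.
by apply: measurable_dotv => // k; exact: adapted_dist.
Qed.

Let dotv_sqr_le u : dotv v u ^+ 2 <= dotv u u.
Proof. by rewrite (le_trans (dotv_CS_sqr _ _))// v1 mul1r. Qed.

Let integrable_z2 i : L1 (fun t => z i t ^+ 2).
Proof.
apply: (integrable_real_le (g := fun t =>
  2 * dotv v (grad J x) ^+ 2 + 2 * l ^+ 2 * dotv (w i t - x) (w i t - x))).
- by apply: measurable_funX; exact: (@adapted_measurable i).
- move=> t; rewrite ger0_norm ?sqr_ge0// /z.
  have := ler_wpM2l (sqr_ge0 l) (dotv_sqr_le (w i t - x)).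
  move: (dotv v (grad J x)) (dotv v (w i t - x)) (dotv (w i t - x) _) => a b c h.
  by have := sqr_ge0 (a + l * b); nra.
apply: integrable_realD => //; first exact: integrable_real_cst.
by apply: integrable_realZ => //; exact: integrable_dist2.
Qed.

Let z_step i t : z i.+1 t = z i t + mu * l * (dotv v (g i t) + dotv v (s i t)).
Proof.
rewrite /z iterates_step; move: (s i t) (g i t) => b a.
by rewrite !(dotvBr, dotvDr, dotvZr, dotvNr); ring.
Qed.

(** Writing [b = <v, g>] and [a = z i], the bound [2 a b >= - (b - a)^2 / 2] gives up the
    exponential growth and keeps only the injected noise, at the price of the squared linearization
    error. *)
Lemma direction_step_ge i (A : set T) : F i A ->
  L1 (fun t => dotv v (s i t) ^+ 2) ->
  E A (fun t => z i t ^+ 2)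
    - mu * delta / 2 * rho ^+ 2 * E A (fun t => dotv (w i t - x) (w i t - x) ^+ 2)
    + mu ^+ 2 * tau ^+ 2 * E A (fun t => dotv v (s i t) ^+ 2)
  <= E A (fun t => z i.+1 t ^+ 2).
Proof.
move=> FA ivs; have mA := filtration_measurable FA.
have l0 : 0 <= l by exact: le_trans tau_le.
(* The coefficient of [<v, s>] in the expanded square; it is known at time [i], so the cross term
   integrates to zero. *)
pose y t := 2 * mu * l * (z i t + mu * l * dotv v (g i t)).
have my : measurable_fun setT (y : Ti i -> R).
  apply: measurable_funM => //; apply: measurable_funD; first exact: measurable_z.
  apply: measurable_funM => //.
  by apply: measurable_dotv => // k; exact: adapted_grad.
have [i0 e0] : L1 (fun t => dotv (s i t) (y t *: v)) /\ E A (fun t => dotv (s i t) (y t *: v)) = 0.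
  pose c := 2 * mu * l; pose c' := mu * l.
  apply: (@dot_noise_eq0 _ _ (fun t => dotv (s i t) (s i t) +
    (2 * c ^+ 2 * z i t ^+ 2 + 2 * c ^+ 2 * c' ^+ 2 * dotv (g i t) (g i t)))) => //.
  - move=> k; under eq_fun do rewrite mxE.
    exact: measurable_funM.
  - move=> k t; apply: le_trans (normr_coordM_le_dotv _ _ k) _; rewrite lerD2l.
    rewrite dotvZl dotvZr v1 mulr1 /y -/c -/c'.
    have := ler_wpM2l (mulr_ge0 (sqr_ge0 c) (sqr_ge0 c')) (dotv_sqr_le (g i t)).
    move: (z i t) (dotv v (g i t)) (dotv (g i t) _) c c' => a b e c c' h.
    by have := mulr_ge0 (sqr_ge0 c) (sqr_ge0 (a - c' * b)); lra.
  - apply: integrable_realD => //; first exact: integrable_noise2.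
    apply: integrable_realD => //; apply: integrable_realZ => //.
    exact: integrable_grad2.
have := @Rintegral_ge_lincomb _ _ _ P A (fun t => z i.+1 t ^+ 2)
  [:: (1, fun t => z i t ^+ 2);
      (- (mu * delta / 2 * rho ^+ 2), fun t => dotv (w i t - x) (w i t - x) ^+ 2);
      (mu ^+ 2 * tau ^+ 2, fun t => dotv v (s i t) ^+ 2); (1, fun t => dotv (s i t) (y t *: v))] mA.
rewrite !big_cons !big_nil/= e0 => H.
apply: le_trans (H _ _ _) => {H}; first by lra.
- exact: (integrable_z2 i.+1).
- by do !split => //; exact: integrable_dist4.
move=> t; rewrite !big_cons !big_nil/= z_step dotvZr (dotvC _ v) /y.
have := linearization i t.
move: (z i t) (dotv v (g i t)) (dotv v (s i t)) (dotv (w i t - x) _ ^+ 2) => a b c U h.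
have h1 : mu * l / 2 * (b - a) ^+ 2 <= mu * delta / 2 * (rho ^+ 2 * U).
  have k1 : mu * l <= mu * delta by rewrite ler_wpM2l// ltW.
  have k2 : mu * l / 2 <= mu * delta / 2 by lra.
  apply: le_trans (ler_wpM2r (sqr_ge0 (b - a)) k2) _; apply: ler_wpM2l => //.
  by rewrite divr_ge0// mulr_ge0// ltW.
have h2 : mu ^+ 2 * tau ^+ 2 * c ^+ 2 <= mu ^+ 2 * l ^+ 2 * c ^+ 2.
  by rewrite ler_wpM2r ?sqr_ge0// ler_wpM2l ?sqr_ge0// lerXn2r.
have h3 : 0 <= mu * l * (a + b) ^+ 2 by rewrite mulr_ge0 ?sqr_ge0// mulr_ge0// ltW.
have h4 : 0 <= (mu * l * b) ^+ 2 by rewrite sqr_ge0.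
have h5 : 0 <= mu * l * b ^+ 2 by rewrite mulr_ge0 ?sqr_ge0// mulr_ge0// ltW.
by lra.
Qed.

Lemma grad2_ge_direction i (A : set T) : F i A ->
  2^-1 * E A (fun t => z i t ^+ 2)
    - rho ^+ 2 * E A (fun t => dotv (w i t - x) (w i t - x) ^+ 2)
  <= E A (fun t => dotv (g i t) (g i t)).
Proof.
move=> FA; have mA := filtration_measurable FA.
have := @Rintegral_ge_lincomb _ _ _ P A (fun t => dotv (g i t) (g i t))
  [:: (2^-1, fun t => z i t ^+ 2); (- rho ^+ 2, fun t => dotv (w i t - x) (w i t - x) ^+ 2)] mA.
rewrite !big_cons !big_nil/= => H.
apply: le_trans (H _ _ _) => {H}; first by lra.
- exact: integrable_grad2.
- by do !split => //; exact: integrable_dist4.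
move=> t; rewrite !big_cons !big_nil/=.
have := linearization i t; have := dotv_sqr_le (g i t).
move: (z i t) (dotv v (g i t)) (dotv (g i t) _) (dotv (w i t - x) _ ^+ 2) => a b G U h1 h2.
by have := sqr_ge0 (2 * b - a); lra.
Qed.


(** All the quantities of [escape_recursion] are read from time [j] on. Starting within squared
    distance [mu] of [x] gives the initial fourth moment [mu ^+ 2 * q]. Half of the variance
    [sigmal ^+ 2] is spent on the Hoelder error, and [kappa] turns [kappa * 2 <= t2 * s] into an
    equality. *)
Lemma escape_from_reference Rs betaR gamma sigmal eta Kg Cg A0 L j (A : set T) :
  noise_covariance P J ghat w0 Rs mu -> hoelder_covariance Rs betaR gamma ->
  (forall a, 0 <= a -> a `^ gamma <= eta + Kg * a ^+ 4) -> 0 <= Kg ->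
  `|betaR| * eta <= sigmal ^+ 2 / 2 -> sigmal ^+ 2 <= dotv v (v *m Rs x) ->
  0 <= Cg -> dotv (grad J x) (grad J x) <= Cg * mu ->
  F j A -> (forall t, A t -> dotv (w j t - x) (w j t - x) <= mu) ->
  2^-1 <= c1 delta beta mu ->
  let B := 2 * expR (dist4_rate Cg * (A0 + 1)) in
  let kappa := tau ^+ 2 * sigmal ^+ 2 / 4 in
  mu * (delta / 2 * rho ^+ 2 * B + tau ^+ 2 * (`|betaR| * Kg) * B) <= kappa ->
  8 * (c2 delta sigma + 2) <= kappa * A0 ->
  mu * (kappa / 8 + rho ^+ 2 * B / 2) <= 1 ->
  A0 <= L%:R * mu -> L%:R * mu <= A0 + 1 ->
  E A (fun t => J (w (j + L) t)) <=
  E A (fun t => J (w j t)) - mu ^+ 2 * L%:R * fine (P A).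
Proof.
move=> hcov hol hK Kg0 heta hsl Cg0 gx FA hA hc1 B kappa h1 h2 h3 h4 h5.
have mA := filtration_measurable FA.
have FAi i : F (j + i)%N A by exact: (filtration_mono (leq_addr i j)).
have q0 : 0 <= fine (P A) by exact: fine_ge0.
have K0 : 0 <= dist4_rate Cg.
  rewrite /dist4_rate; have := exprn_ge0 4 beta_ge0; have := exprn_ge0 4 (ltW sigma_gt0).
  have := exprn_ge0 4 (ltW delta_gt0); have := sqr_ge0 Cg.
  move: (beta ^+ 4) (sigma ^+ 4) (delta ^+ 4) (Cg ^+ 2) => b s' d' c a1 a2 a3 a4.
  by have := mulr_ge0 a4 (addr_ge0 a1 a2); lra.
pose b i := E A (fun t => dotv (w (j + i) t - x) (w (j + i) t - x) ^+ 2).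
have b0 : b 0 <= mu ^+ 2 * fine (P A).
  rewrite -Rintegral_cst// /b addn0; apply: le_Rintegral => //.
  - by apply: integrable_realS => //; exact: integrable_dist4.
  - exact: integrable_real_cst.
  move=> t At; apply: lerXn2r; rewrite ?nnegrE ?dotvv_ge0//; first exact: ltW.
  exact: hA.
have bS i : b i.+1 <= (1 + dist4_rate Cg * mu) * b i + dist4_rate Cg * mu ^+ 3 * fine (P A).
  by rewrite /b addnS; exact: dist4_step_le.
have B0 : 0 <= B by rewrite mulr_ge0// expR_ge0.
have kap0 : 0 <= kappa by rewrite divr_ge0// mulr_ge0 ?sqr_ge0.
have := @escape_recursion R (fun i => E A (fun t => z (j + i) t ^+ 2)) b
  (fun i => E A (fun t => J (w (j + i) t)))
  (fun i => E A (fun t => dotv (g (j + i) t) (g (j + i) t)))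
  (fun i => E A (fun t => dotv v (s (j + i) t) ^+ 2)) mu (fine (P A)) (dist4_rate Cg)
  B A0 kappa (c1 delta beta mu) (c2 delta sigma) (delta / 2 * rho ^+ 2) (rho ^+ 2)
  (tau ^+ 2) (sigmal ^+ 2 / 2) (`|betaR| * Kg) L.
rewrite addn0; apply => //.
- by rewrite mulr_ge0 ?sqr_ge0// divr_ge0// ltW.
- exact: sqr_ge0.
- exact: sqr_ge0.
- exact: mulr_ge0.
- move=> i iL; apply: (perturbed_growth_le (K := dist4_rate Cg)) => //; first exact: ltW.
  by apply: le_trans h5; rewrite ler_wpM2r ?(ltW mu_gt0)// ler_nat ltnW.
- by apply: Rintegral_ge0 => t _; exact: sqr_ge0.
- move=> i; rewrite addnS; have [ivs _ _] := noise_direction_covariance v hcov (FAi i).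
  by have := direction_step_ge (FAi i) ivs; rewrite /b; lra.
- move=> i; have := noise_direction_ge x hcov hol hK v1 (FAi i).
  have : (sigmal ^+ 2 / 2) * fine (P A) <= (dotv v (v *m Rs x) - `|betaR| * eta) * fine (P A).
    by rewrite ler_wpM2r//; lra.
  by rewrite /b; lra.
- by move=> i; rewrite addnS; exact: value_step_le.
- by move=> i; apply: Rintegral_ge0 => t _; exact: dotvv_ge0.
- by move=> i; exact: grad2_ge_direction.
- by rewrite /kappa; lra.
Qed.

End Unstable_direction.

(** The entries [(k, l)] and [(l, k)] are versions of the conditional expectation of the same
    product, so they agree almost surely along the trajectory. *)
Lemma covariance_symmetric_ae Rs i : noise_covariance P J ghat w0 Rs mu ->
  {ae P, forall t, (Rs (w i t))^T = Rs (w i t)}.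
Proof.
move=> hcov.
have h k l : {ae P, forall t, Rs (w i t) k l - Rs (w i t) l k = 0}.
  have [i1 i2 m1 e1] := hcov i k l; have [_ i2' m2 e2] := hcov i l k.
  apply: (@eq0_Rintegral_ae _ _ _ _ (coordinate_events i)).
  - exact: filtration_measurable.
  - exact: integrable_realB.
  - by apply: measurable_funB => _ B mB; rewrite setTI; [exact: m1|exact: m2].
  move=> A FA; have mA := filtration_measurable FA.
  rewrite RintegralB//; [|exact: integrable_realS|exact: integrable_realS].
  rewrite /Rintegral -e1// -e2//; apply/eqP; rewrite subr_eq0; apply/eqP.
  congr fine; apply: eq_integral => t _; congr EFin; rewrite !mxE.
  by apply: eq_bigr => a _; rewrite !mxE mulrC.
have : {ae P, forall t, forall kl : 'I_m * 'I_m, Rs (w i t) kl.1 kl.2 - Rs (w i t) kl.2 kl.1 = 0}.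
  by apply: filter_forall => -[k l]; exact: h.
apply: filterS => t ht; apply/matrixP => k l; rewrite mxE.
by apply/eqP; rewrite -subr_eq0; apply/eqP; exact: (ht (l, k)).
Qed.

(* The event is cut into cells on which [w j] varies by less than [mu]; one
   deterministic reference point, hence one deterministic unstable direction, serves
   a whole cell, and no measurable selection of eigenvectors is needed. *)
Lemma saddle_descent Rs rho tau betaR gamma sigmal eta Kg Cg A0 L
    (S : set 'rV[R]_m) j (A : set T) :
  0 <= rho -> lipschitz_hessian J rho -> 0 < tau ->
  noise_covariance P J ghat w0 Rs mu -> hoelder_covariance Rs betaR gamma ->
  noise_at_saddles J Rs sigmal S ->
  (forall a, 0 <= a -> a `^ gamma <= eta + Kg * a ^+ 4) -> 0 <= Kg ->
  `|betaR| * eta <= sigmal ^+ 2 / 2 -> 0 <= Cg ->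
  (forall x, S x -> dotv (grad J x) (grad J x) <= Cg * mu /\
    lambda_min (hess J x) <= - tau) ->
  F j A -> (forall t, A t -> S (w j t)) ->
  2^-1 <= c1 delta beta mu ->
  let B := 2 * expR (dist4_rate Cg * (A0 + 1)) in
  let kappa := tau ^+ 2 * sigmal ^+ 2 / 4 in
  mu * (delta / 2 * rho ^+ 2 * B + tau ^+ 2 * (`|betaR| * Kg) * B) <= kappa ->
  8 * (c2 delta sigma + 2) <= kappa * A0 ->
  mu * (kappa / 8 + rho ^+ 2 * B / 2) <= 1 ->
  A0 <= L%:R * mu -> L%:R * mu <= A0 + 1 ->
  E A (fun t => J (w (j + L) t)) <=
  E A (fun t => J (w j t)) - mu ^+ 2 * L%:R * fine (P A).
Proof.
move=> rho0 hhess tau0 hcov hol hns hK Kg0 heta Cg0 hS FA hA hc1 B kappa h1 h2 h3 h4 h5.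
have mA := filtration_measurable FA.
(* The mesh is chosen so that [m] coordinates, each within the mesh, give a squared distance at most
   [mu]; the successor keeps the divisor nonzero. *)
have [eta' etaE] : exists r, r = mu / m.+1%:R by exists (mu / m.+1%:R).
have eta0 : 0 < eta' by rewrite etaE divr_gt0.
pose cell t : 'rV[int]_m := \row_k Num.floor (w j t 0 k / eta').
pose f t := J (w (j + L) t) - (J (w j t) - mu ^+ 2 * L%:R).
have if1 : L1 (fun t => J (w j t) - mu ^+ 2 * L%:R).
  by apply: integrable_realB => //; [exact: integrable_value|exact: integrable_real_cst].
have if0 : L1 f by apply: integrable_realB => //; exact: integrable_value.
have Ef (D : set T) : measurable D -> E D f = E D (fun t => J (w (j + L) t)) -
    (E D (fun t => J (w j t)) - mu ^+ 2 * L%:R * fine (P D)).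
  move=> mD; rewrite RintegralB//;
    [|apply: integrable_realS => //; exact: integrable_value|exact: integrable_realS].
  rewrite RintegralB ?Rintegral_cst//; apply: integrable_realS => //; first exact: integrable_value.
  exact: integrable_real_cst.
suff : E A f <= 0 by rewrite Ef// subr_le0.
have Fcell n : F j (A `&` (pickle \o cell) @^-1` [set n]).
  apply: (@measurableI _ (Ti j)) => //.
  have [[r rn]|nr] := pselect (exists r : 'rV[int]_m, pickle r = n); last first.
    rewrite (_ : _ @^-1` _ = set0); first exact: (@measurable0 _ (Ti j)).
    by apply/seteqP; split => // t /= e; apply: nr; exists (cell t).
  have -> : (pickle \o cell) @^-1` [set n] =
      \bigcap_(k in [set: 'I_m]) [set t | Num.floor (w j t 0 k / eta') = r 0 k].
    apply/seteqP; split => t /=; rewrite -rn.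
      by move=> /(pcan_inj pickleK) <- k _; rewrite /= mxE.
    by move=> h; congr pickle; apply/rowP => k; rewrite mxE h.
  apply: (@fin_bigcap_measurable _ (Ti j)) => // k _.
  apply: (@measurable_set_floor R _ (Ti j)).
  by apply: measurable_funM => //; exact: adapted_iterates.
apply: (@le0_Rintegral_partition _ _ _ _ _ (pickle \o cell)) => // n.
  exact: filtration_measurable (Fcell n).
set D := A `&` _; have FD : F j D by exact: Fcell.
have mD := filtration_measurable FD.
have [PD|PD] := eqVneq (P D) 0%E.
  by rewrite /Rintegral null_set_integral//; apply: measurable_funTS; exact: measurable_int if0.
have [N [mN PN hN]] := covariance_symmetric_ae j hcov.
(* A cell of positive probability is not contained in the null set where the covariance may fail to
   be symmetric, so a reference outcome exists. *)
have [t0 [[At0 ct0] Nt0]] : exists t0, D t0 /\ ~ N t0.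
  apply: contrapT => h; move/eqP: PD; apply; apply/eqP; rewrite eq_le measure_ge0 andbT.
  rewrite -PN le_measure ?inE// => t Dt; apply: contrapT => Nt.
  by apply: h; exists t.
have sym : (Rs (w j t0))^T = Rs (w j t0) by apply: contrapT => /hN.
have Sx := hA _ At0; have [gx lx] := hS _ Sx.
have hlb a : eigenvalue (hess J (w j t0)) a -> - delta <= a.
  apply: eigenvalue_lbound => u; apply: enorm_mul_hess_le => //; first exact: ltW.
  by case: hdiff.
have [v [l [v1 tl hv hsl]]] := noise_at_saddle_direction tau0 hlb hns Sx lx sym.
have ev : enorm v = 1 by rewrite enormE v1 sqrtr1.
have ld : l <= delta.
  have := dotv_mul_hess_le (w j t0) (- v) v hdiff.2 hgrad.
  have -> : enorm (- v) = 1 by rewrite enormE dotvNl dotvNr opprK v1 sqrtr1.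
  by rewrite hv dotvNr v1 ev !mulr1 mulrN1 opprK.
rewrite Ef// subr_le0.
apply: (escape_from_reference (A0 := A0) rho0 hhess (ltW tau0) tl ld v1 hv
  hcov hol hK Kg0 heta hsl Cg0 gx FD) => //.
move=> t [At ct].
have close k : `|(w j t - w j t0) 0 k| <= eta'.
  have : cell t = cell t0 by apply: (pcan_inj pickleK); rewrite [LHS]ct [RHS]ct0.
  move=> /rowP/(_ k); rewrite !mxE => e.
  have /andP[a1 a2] := floor_itv (w j t 0 k / eta').
  have /andP[] := floor_itv (w j t0 0 k / eta'); rewrite -e => b1 b2.
  move: a1 a2 b1 b2; rewrite !ler_pdivlMr// !ltr_pdivrMr// rmorphD/= mulrDl mul1r => *.
  by rewrite ler_norml; lra.
apply: le_trans (_ : \sum_(k < m) eta' ^+ 2 <= _).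
  apply: ler_sum => k _; rewrite -expr2 -real_normK ?num_real// lerXn2r ?nnegrE//.
  exact: ltW.
rewrite sumr_const card_ord -mulr_natl etaE expr_div_n mulrCA -[leRHS]mulr1 expr2 -!mulrA.
rewrite ler_wpM2l ?(ltW mu_gt0)// mulrA ler_pdivrMr ?exprn_gt0// mul1r.
apply: le_trans (_ : 1 * m%:R <= _); first by rewrite ler_wpM2r.
by rewrite mul1r -natrX ler_nat expnS expn1 mulSn (leq_trans (leqnSn m))// leq_addr.
Qed.

(** * Probability of avoiding M *)

Lemma integrable_gap i : L1 (fun t => J (w i t) - Jo).
Proof.
by apply: integrable_realB => //; [exact: integrable_value|exact: integrable_real_cst].
Qed.

Lemma Rintegral_gap i (A : set T) : measurable A ->
  E A (fun t => J (w i t) - Jo) = E A (fun t => J (w i t)) - Jo * fine (P A).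
Proof.
move=> mA; rewrite RintegralB ?Rintegral_cst//; apply: integrable_realS => //.
  exact: integrable_value.
exact: integrable_real_cst.
Qed.

Lemma Rintegral_gap_ge0 i (A : set T) : 0 <= E A (fun t => J (w i t) - Jo).
Proof. by apply: Rintegral_ge0 => t _; rewrite subr_ge0. Qed.

Definition hits (M : set 'rV[R]_m) j k : set T :=
  [set t | exists i, (j <= i < j + k)%N /\ M (w i t)].

Lemma hits_measurable (M : set 'rV[R]_m) j k :
  (forall i, F i (w i @^-1` M)) -> measurable (hits M j k).
Proof.
move=> FM; rewrite (_ : hits M j k = \bigcup_(i in [set i | (j <= i < j + k)%N]) (w i @^-1` M)).
  by apply: bigcup_measurable => i _; exact: filtration_measurable (FM i).
by apply/seteqP; split => [t [i [h1 h2]]|t [i h1 h2]]; exists i.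
Qed.

(* Each step spent outside [M] is paid for by a decrease of the expected
   gap: one step at a time on [G], [L] steps at a time on [S]. *)
Lemma hitting_bound (M S G : set 'rV[R]_m) (kap : R) (L : nat) :
  (forall x, [\/ M x, S x | G x]) -> 0 <= kap -> (0 < L)%N ->
  (forall i, F i (w i @^-1` M)) -> (forall i, F i (w i @^-1` S)) ->
  (forall i, F i (w i @^-1` G)) ->
  (forall j A, F j A -> (forall t, A t -> G (w j t)) ->
    E A (fun t => J (w j.+1 t)) <= E A (fun t => J (w j t)) - kap * fine (P A)) ->
  (forall j A, F j A -> (forall t, A t -> S (w j t)) ->
    E A (fun t => J (w (j + L) t)) <=
    E A (fun t => J (w j t)) - kap * L%:R * fine (P A)) ->
  forall k j A, F j A ->
    kap * k%:R * fine (P (A `\` hits M j k)) <= E A (fun t => J (w j t) - Jo).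
Proof.
move=> cover kap0 L0 FM FS FG hG hS.
(* Strong induction, as an epoch lowers the remaining horizon by [L] at once. *)
elim/ltn_ind => -[_ j A _|k IH j A FA].
  by rewrite mulr0 mul0r; exact: Rintegral_gap_ge0.
have mA := filtration_measurable FA.
(* The two events are made disjoint so that their gaps add up; the part of [A] already in M is
   dropped, since the gap is nonnegative. *)
pose AG := A `&` (w j @^-1` G); pose AS := A `&` (w j @^-1` S `\` w j @^-1` G).
have FAG : F j AG by exact: (@measurableI _ (Ti j) _ _ FA (FG j)).
have FAS : F j AS.
  exact: (@measurableI _ (Ti j) _ _ FA (@measurableD _ (Ti j) _ _ (FS j) (FG j))).
have mAG := filtration_measurable FAG; have mAS := filtration_measurable FAS.
have mh j' k' := @hits_measurable M j' k' FM.
set XG := AG `\` hits M j.+1 k; set XS := AS `\` hits M (j + L) (k.+1 - L).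
have mXG : measurable XG by exact: measurableD.
have mXS : measurable XS by exact: measurableD.
have split : A `\` hits M j k.+1 `<=` XG `|` XS.
  move=> t [At nh]; have [Mt|St|Gt] := cover (w j t).
  - by exfalso; apply: nh; exists j; rewrite leqnn addnS ltnS leq_addr.
  - have [Gt|nGt] := pselect (G (w j t)).
      left; split => // -[i [/andP[i1 i2] Mi]]; apply: nh; exists i.
      by rewrite (ltnW i1) addnS -addSn i2.
    right; split => // -[i [/andP[i1 i2] Mi]]; apply: nh; exists i; split => //.
    rewrite (leq_trans (leq_addr L j) i1)/=.
    have [Lk|kL] := leqP L k.+1; first by rewrite -addnA subnKC in i2.
    by move: i2; rewrite (eqP (ltnW kL : k.+1 - L == 0)%N) addn0 ltnNge i1.
  left; split => // -[i [/andP[i1 i2] Mi]]; apply: nh; exists i.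
  by rewrite (ltnW i1) addnS -addSn i2.
have hP := probability_le_union P (measurableD mA (mh j k.+1)) mXG mXS split.
have PG : fine (P XG) <= fine (P AG).
  by rewrite fine_le ?fin_num_measure// le_measure ?inE// => t [].
have PS : fine (P XS) <= fine (P AS).
  by rewrite fine_le ?fin_num_measure// le_measure ?inE// => t [].
have kL : (k.+1 - L < k.+1)%N by rewrite ltn_subrL L0.
have IG := IH k (ltnSn k) j.+1 AG (filtration_mono (leqnSn j) FAG).
have IS := IH _ kL (j + L)%N AS (filtration_mono (leq_addr L j) FAS).
have dG := hG j AG FAG (fun t => @proj2 _ _).
have dS := hS j AS FAS (fun t h => h.2.1).
have sum : E AG (fun t => J (w j t) - Jo) + E AS (fun t => J (w j t) - Jo)
    <= E A (fun t => J (w j t) - Jo).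
  have mU : measurable (AG `|` AS) by exact: measurableU.
  have iU := integrable_realS mU (integrable_gap j).
  have iA := integrable_realS mA (integrable_gap j).
  rewrite -Rintegral_setU//; last first.
    by apply/disj_setPS => t [[_ h1] [_ [_ h2]]].
  rewrite /Rintegral fine_le ?integrable_fin_num//.
  apply: ge0_subset_integral => //.
  - apply: measurable_funTS; apply/measurable_EFinP.
    exact/integrable_real_measurable/integrable_gap.
  - by move=> t _; rewrite lee_fin subr_ge0.
  - by move=> t [[]|[]].
rewrite -/XG Rintegral_gap// in IG; rewrite -/XS Rintegral_gap// in IS.
rewrite !Rintegral_gap// in sum; rewrite Rintegral_gap//.
(* The subtraction is truncated: an epoch that overshoots the horizon leaves 0 steps, and its
   descent still covers the [k.+1] steps to be paid for. *)
have kk : k.+1%:R <= (k.+1 - L)%:R + L%:R :> R.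
  by rewrite -natrD ler_nat addnC -leq_subLR.
have pG0 : 0 <= fine (P XG) by exact: fine_ge0.
have pS0 : 0 <= fine (P XS) by exact: fine_ge0.
have n1 := ler_wpM2l (mulr_ge0 kap0 (ler0n R k.+1)) hP.
have n2 := ler_wpM2l kap0 PG.
have n3 := ler_wpM2l (mulr_ge0 kap0 (ler0n R L)) PS.
have n4 := ler_wpM2r (mulr_ge0 kap0 pS0) kk.
rewrite -natr1 in n1 n4 *.
by lra.
Qed.

Lemma adapted_large_gradient i p : F i (w i @^-1` large_gradient J delta beta sigma p mu).
Proof.
rewrite (_ : _ @^-1` _ = [set t | mu * (c2 delta sigma / c1 delta beta mu) * (1 + p^-1)
    <= dotv (g i t) (g i t)]); last first.
  by apply/seteqP; split => t; rewrite /large_gradient/= sqr_enorm.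
apply: (@measurable_set_le R _ (Ti i)) => //.
by apply: measurable_dotv => k; exact: adapted_grad.
Qed.

Lemma adapted_lambda_min_le i tau rho : 0 < tau -> lipschitz_hessian J rho ->
  F i [set t | lambda_min (hess J (w i t)) <= - tau].
Proof.
move=> tau0 hhess.
apply: (@measurable_lambda_min_le R _ (Ti i) _ _ (- delta)) => // [k l|t a].
  apply: (@measurable_continuous_comp _ _ (Ti i) _ _ (fun x => hess J x k l)).
    by move=> k'; exact: adapted_iterates.
  exact: hess_entry_continuous hhess.
apply: eigenvalue_lbound => u; apply: enorm_mul_hess_le => //; first exact: ltW.
by case: hdiff.
Qed.

Lemma adapted_strict_saddle i tau rho p : 0 < tau -> lipschitz_hessian J rho ->
  F i (w i @^-1` strict_saddle J delta beta sigma p tau mu).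
Proof.
move=> tau0 hhess; apply: (@measurableI _ (Ti i) (~` _)).
  by apply: (@measurableC _ (Ti i)); exact: adapted_large_gradient.
exact: adapted_lambda_min_le hhess.
Qed.

Lemma adapted_second_order_stationary i tau rho p :
  0 < tau -> lipschitz_hessian J rho ->
  F i (w i @^-1` second_order_stationary J delta beta sigma p tau mu).
Proof.
move=> tau0 hhess; apply: (@measurableI _ (Ti i) (~` _)).
  by apply: (@measurableC _ (Ti i)); exact: adapted_large_gradient.
rewrite (_ : (fun t => _) = ~` [set t | lambda_min (hess J (w i t)) <= - tau]).
  by apply: (@measurableC _ (Ti i)); exact: adapted_lambda_min_le hhess.
by apply/seteqP; split => t /=; [move=> h; apply/negP; rewrite -ltNge|move/negP; rewrite -ltNge].
Qed.

(** In the threshold defining G, the summand 1 of [1 + p^-1] cancels the noise gain [mu ^+ 2 * c2]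
    and the summand [p^-1] is the net descent. *)
Lemma large_gradient_descent p i (A : set T) : 0 < p ->
  2^-1 <= c1 delta beta mu -> F i A ->
  (forall t, A t -> large_gradient J delta beta sigma p mu (w i t)) ->
  E A (fun t => J (w i.+1 t)) <=
  E A (fun t => J (w i t)) - mu ^+ 2 * c2 delta sigma / p * fine (P A).
Proof.
move=> p0 hc1 FA hA; have mA := filtration_measurable FA.
have c10 : 0 < c1 delta beta mu by apply: lt_le_trans hc1; rewrite invr_gt0.
set c := mu * (c2 delta sigma / c1 delta beta mu) * (1 + p^-1).
have h : c * fine (P A) <= E A (fun t => dotv (g i t) (g i t)).
  rewrite -Rintegral_cst//; apply: le_Rintegral => //.
  - exact: integrable_real_cst.
  - by apply: integrable_realS => //; exact: integrable_grad2.
  by move=> t /hA; rewrite /large_gradient/= sqr_enorm.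
apply: le_trans (value_step_le FA) _.
have := ler_wpM2l (ltW (mulr_gt0 mu_gt0 c10)) h.
have -> : mu * c1 delta beta mu * (c * fine (P A)) =
    mu ^+ 2 * c2 delta sigma * fine (P A) + mu ^+ 2 * c2 delta sigma / p * fine (P A).
  by rewrite /c; move: (c1 delta beta mu) c10 => c1' h1; field; rewrite !gt_eqF.
by lra.
Qed.

(* Junk value: [0] if [M] is not visited before time [k]. *)
Fixpoint last_visit (M : set 'rV[R]_m) (k : nat) (t : T) : nat :=
  match k with
  | 0%N => 0%N
  | k'.+1 => if asbool (M (w k' t)) then k' else last_visit M k' t
  end.

Lemma last_visit_le M k t : (last_visit M k t <= k.-1)%N.
Proof.
elim: k => //= k IH; case: asboolP => // _.
by rewrite (leq_trans IH)// leq_pred.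
Qed.

Lemma last_visit_hits M k t : hits M 0 k t -> M (w (last_visit M k t) t).
Proof.
elim: k => [[i [/andP[]]]|k IH [i [/andP[_ ik] Mi]]]; first by [].
rewrite /=; case: asboolP => [//|nM]; apply: IH; exists i; split => //.
rewrite /= add0n ltn_neqAle -ltnS ik andbT.
by apply: contra_notN nM => /eqP <-.
Qed.

Lemma measurable_last_visit M k : (forall i, F i (w i @^-1` M)) ->
  measurable_fun setT (last_visit M k).
Proof.
move=> FM; elim: k => [|k IH]; first exact: measurable_cst.
apply: (@measurable_fun_ifT _ _ _ _ (fun=> k) (last_visit M k)) => //.
apply: (measurable_fun_bool true); rewrite setTI.
rewrite (_ : _ @^-1` _ = w k @^-1` M); first exact: filtration_measurable (FM k).
by apply/seteqP; split => t /= /asboolP.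
Qed.

Lemma measurable_at_last_visit M k : (forall i, F i (w i @^-1` M)) ->
  measurable [set t | M (w (last_visit M k t) t)].
Proof.
move=> FM.
rewrite (_ : [set t | _] = \bigcup_i (last_visit M k @^-1` [set i] `&` w i @^-1` M)).
  apply: bigcupT_measurable => i; apply: measurableI.
    by rewrite -[X in measurable X]setTI; exact: measurable_last_visit.
  exact: filtration_measurable (FM i).
by apply/seteqP; split => [t Mt|t [i _ [/= <-]]//]; exists (last_visit M k t).
Qed.

End Stochastic_gradient.

(** * Reaching an approximate second-order stationary point *)

Section Reaching_stationarity.
Context {R : realType}.

(** From [exp (y / 2) (1 - y / 2) <= 1 <= (1 + y) (1 - y / 2)]. *)
Lemma ln1D_ge_half (y : R) : 0 <= y -> y <= 1 -> y / 2 <= ln (1 + y).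
Proof.
move=> y0 y1; rewrite -ler_expR lnK ?posrE; last by lra.
have h := expR_ge1Dx (- (y / 2)).
have e : expR (y / 2) * expR (- (y / 2)) = 1 by rewrite -expRD subrr expR0.
have h' : expR (y / 2) * (1 - y / 2) <= 1.
  by rewrite -[leRHS]e ler_wpM2l ?expR_ge0.
have u0 : 0 < 1 - y / 2 by lra.
rewrite -(ler_pM2r u0) (le_trans h')//.
by have := mulr_ge0 y0 (_ : 0 <= 1 - y); rewrite subr_ge0 => /(_ y1); lra.
Qed.

(** Brings each smallness condition on [mu] to the form of a neighbourhood of 0; [X + 1] avoids
    dividing by zero. *)
Lemma mulr_le_of_lt_divD1 (mu X Y : R) : 0 <= mu -> 0 <= X ->
  mu < Y / (X + 1) -> mu * X <= Y.
Proof.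
move=> mu0 X0; rewrite ltr_pdivlMr ?ltr_wpDl// => h.
by apply: le_trans (ltW h); rewrite mulrDr mulr1 lerDl.
Qed.

(** The lower bound on [L mu] secures the descent; the upper one keeps the exponential bound on the
    fourth moment uniform in [mu]. *)
Lemma epoch_length (A mu : R) : 0 <= A -> 0 < mu -> mu <= 1 ->
  exists L : nat, [/\ (0 < L)%N, A <= L%:R * mu & L%:R * mu <= A + 1].
Proof.
move=> A0 mu0 mu1; exists (Num.truncn (A / mu)).+1; split => //.
  by rewrite -ler_pdivrMr// ltW// truncnS_gt.
have h : (Num.truncn (A / mu))%:R <= A / mu by rewrite truncn_le divr_ge0// ltW.
by rewrite -natr1 mulrDl mul1r lerD// -ler_pdivlMr.
Qed.

Lemma second_order_stationary_cover m (J : 'rV[R]_m -> R) delta beta sigma p tau mu x :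
  [\/ second_order_stationary J delta beta sigma p tau mu x,
      strict_saddle J delta beta sigma p tau mu x |
      large_gradient J delta beta sigma p mu x].
Proof.
have [G|nG] := pselect (large_gradient J delta beta sigma p mu x); first exact: Or33.
by have [h|h] := leP (lambda_min (hess J x)) (- tau); [apply: Or32|apply: Or31].
Qed.

Lemma small_gradient_le m (J : 'rV[R]_m -> R) delta beta sigma p mu x :
  0 < mu -> 0 <= c2 delta sigma -> 0 < p -> 2^-1 <= c1 delta beta mu ->
  ~ large_gradient J delta beta sigma p mu x ->
  enorm (grad J x) ^+ 2 <= 2 * c2 delta sigma * (1 + p^-1) * mu.
Proof.
move=> mu0 c20 p0 hc1 /negP; rewrite -ltNge => /ltW /le_trans; apply.
have c10 : 0 < c1 delta beta mu by apply: lt_le_trans hc1; rewrite invr_gt0.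
have c1V : (c1 delta beta mu)^-1 <= 2 by rewrite invf_ple ?posrE.
have pV : 0 <= 1 + p^-1 by rewrite addr_ge0// invr_ge0 ltW.
have := ler_wpM2l (mulr_ge0 (mulr_ge0 (ltW mu0) c20) pV) c1V.
by lra.
Qed.

Lemma stationary_hit_probability m d {T : measurableType d} (P : probability T R)
    (J : 'rV[R]_m -> R) (ghat : nat -> 'rV[R]_m -> T -> 'rV[R]_m)
    (Rs : 'rV[R]_m -> 'M[R]_m) (w0 : 'rV[R]_m)
    (Jo delta rho beta sigma betaR gamma sigmal tau p eta Kg mu : R) :
  0 < delta -> 0 <= rho -> 0 <= beta -> 0 < sigma -> 0 < sigmal ->
  lipschitz_gradient J delta -> twice_differentiable J ->
  lipschitz_hessian J rho -> hoelder_covariance Rs betaR gamma ->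
  (forall x, Jo <= J x) -> 0 < tau -> 0 < p -> p < 1 ->
  (forall a, 0 <= a -> a `^ gamma <= eta + Kg * a ^+ 4) -> 0 <= Kg ->
  `|betaR| * eta <= sigmal ^+ 2 / 2 ->
  let C2 := c2 delta sigma in
  let Cg := 2 * C2 * (1 + p^-1) in
  let kappa := tau ^+ 2 * sigmal ^+ 2 / 4 in
  let A0 := 8 * (C2 + 2) / kappa in
  let B := 2 * expR (dist4_rate delta beta sigma Cg * (A0 + 1)) in
  let k := Num.min 1 C2 in
  0 < mu -> mu <= 1 -> 2^-1 <= c1 delta beta mu ->
  mu * (delta / 2 * rho ^+ 2 * B + tau ^+ 2 * (`|betaR| * Kg) * B) <= kappa ->
  mu * (kappa / 8 + rho ^+ 2 * B / 2) <= 1 ->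
  noise_moments P J ghat w0 beta sigma mu ->
  noise_covariance P J ghat w0 Rs mu ->
  noise_at_saddles J Rs sigmal (strict_saddle J delta beta sigma p tau mu) ->
  let w := iterates ghat mu w0 in
  let M := second_order_stationary J delta beta sigma p tau mu in
  exists io : T -> nat,
    [/\ measurable_fun setT io,
        forall t, (io t)%:R <= (J w0 - Jo) / (mu ^+ 2 * k * p),
        measurable [set t | M (w (io t) t)] &
        ((1 - p)%:E <= P [set t | M (w (io t) t)])%E].
Proof.
move=> delta0 rho0 beta0 sigma0 sigmal0 hgrad hdiff hhess hol hJo tau0 p0 p1 hK Kg0 heta.
move=> C2 Cg kappa A0 B k mu0 mu1 hc1 h1 h3 hmom hcov hns w M.
have C20 : 0 < C2 by rewrite mulr_gt0 ?exprn_gt0// divr_gt0.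
have k0 : 0 < k by rewrite lt_min ltr01.
have k1 : k <= 1 by rewrite ge_min lexx.
have kC : k <= C2 by rewrite ge_min lexx orbT.
have kap0 : 0 < kappa by rewrite divr_gt0// mulr_gt0// exprn_gt0.
have A00 : 0 <= A0 by rewrite divr_ge0 ?(ltW kap0)// mulr_ge0// addr_ge0 ?ltW.
have pV0 : 0 <= 1 + p^-1 by rewrite addr_ge0// invr_ge0 ltW.
have Cg0 : 0 <= Cg by rewrite mulr_ge0// mulr_ge0// ltW.
have [L [L0 AL LA]] := epoch_length A00 mu0 mu1.
have m20 : 0 < mu ^+ 2 by rewrite exprn_gt0.
set S := strict_saddle J delta beta sigma p tau mu in hns.
set G := large_gradient J delta beta sigma p mu.
have FM i : filtration w i (w i @^-1` M).
  exact: (@adapted_second_order_stationary _ _ _ _ J ghat w0 delta beta sigma mu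
    delta0 hgrad hdiff i tau rho p tau0 hhess).
have FS i : filtration w i (w i @^-1` S).
  exact: (@adapted_strict_saddle _ _ _ _ J ghat w0 delta beta sigma mu
    delta0 hgrad hdiff i tau rho p tau0 hhess).
have FG i : filtration w i (w i @^-1` G).
  exact: (@adapted_large_gradient _ _ _ _ J ghat w0 delta beta sigma mu hdiff i p).
have hG j A : filtration w j A -> (forall t, A t -> G (w j t)) ->
    \int[P]_(t in A) J (w j.+1 t) <= \int[P]_(t in A) J (w j t) - mu ^+ 2 * k * fine (P A).
  move=> FA hA.
  have := large_gradient_descent delta0 sigma0 mu0 mu1 hgrad hdiff hJo hmom p0 hc1 FA hA.
  move=> /le_trans; apply; rewrite lerD2l lerN2 ler_wpM2r ?fine_ge0//.
  rewrite -mulrA ler_wpM2l ?(ltW m20)// (le_trans kC)// ler_pdivlMr//.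
  by rewrite ler_piMr// ltW.
have hSx x : S x -> dotv (grad J x) (grad J x) <= Cg * mu /\ lambda_min (hess J x) <= - tau.
  by move=> [nG lx]; split=> //; rewrite -sqr_enorm; apply: (small_gradient_le _ (ltW C20) _ _ nG).
have hA0 : 8 * (C2 + 2) <= kappa * A0 by rewrite /A0 [leRHS]mulrC divfK// gt_eqF.
have hS j A : filtration w j A -> (forall t, A t -> S (w j t)) ->
    \int[P]_(t in A) J (w (j + L)%N t) <=
    \int[P]_(t in A) J (w j t) - mu ^+ 2 * k * L%:R * fine (P A).
  move=> FA hA.
  have := saddle_descent delta0 beta0 sigma0 mu0 mu1 hgrad hdiff hJo hmom rho0 hhess tau0
    hcov hol hns hK Kg0 heta Cg0 hSx FA hA hc1 h1 hA0 h3 AL LA.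
  move=> /le_trans; apply; rewrite lerD2l lerN2 ler_wpM2r ?fine_ge0//.
  by rewrite ler_wpM2r// ler_piMr// ltW.
set D := J w0 - Jo.
have D0 : 0 <= D by rewrite subr_ge0.
have kp : 0 < mu ^+ 2 * k * p by rewrite mulr_gt0// mulr_gt0.
(* One more than the integer part: the times below [N] obey the claimed bound, while [N] itself
   exceeds it, which makes the probability of a miss at most [p]. *)
pose N := (Num.truncn (D / (mu ^+ 2 * k * p))).+1.
have bound := hitting_bound delta0 mu0 mu1 hgrad hdiff hJo hmom
  (second_order_stationary_cover J delta beta sigma p tau mu)
  (ltW (mulr_gt0 m20 k0)) L0 FM FS FG hG hS N
  (@measurableT _ (g_sigma_algebraType (coordinate_events ghat w0 mu 0))).
rewrite setTD in bound.
have mH : measurable (hits ghat w0 mu M 0 N) := hits_measurable hdiff hmom 0 N FM.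
have boundD : mu ^+ 2 * k * N%:R * fine (P (~` hits ghat w0 mu M 0 N)) <= D.
  apply: le_trans bound _.
  change (\int[P]_(t in setT) D <= D).
  have PT : fine (P [set: T]) <= 1 by rewrite probability_setT.
  by rewrite Rintegral_cst// -[leRHS]mulr1 ler_wpM2l.
have miss : fine (P (~` hits ghat w0 mu M 0 N)) <= p.
  have NN : D < mu ^+ 2 * k * p * N%:R by rewrite mulrC -ltr_pdivrMr// truncnS_gt.
  have kN : 0 < mu ^+ 2 * k * N%:R by rewrite mulr_gt0// mulr_gt0.
  rewrite -(ler_pM2l kN) (le_trans boundD)// (le_trans (ltW NN))//.
  by rewrite mulrAC.
have mV : measurable [set t | M (w (last_visit ghat w0 mu M N t) t)].
  exact: (measurable_at_last_visit hdiff hmom).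
(* The index may look ahead up to time [N]; its junk value matters only on outcomes that miss M,
   which are charged to [p]. *)
exists (last_visit ghat w0 mu M N); split => //.
- exact: (measurable_last_visit hdiff hmom).
- move=> t; apply: le_trans (_ : (Num.truncn (D / (mu ^+ 2 * k * p)))%:R <= _).
    by rewrite ler_nat; exact: last_visit_le.
  by rewrite truncn_le divr_ge0// ltW.
apply: le_trans (_ : P (hits ghat w0 mu M 0 N) <= _)%E; last first.
  by rewrite le_measure ?inE// => t; exact: last_visit_hits.
rewrite -[hits _ _ _ _ _ _]setCK probability_setC; last exact: measurableC.
rewrite EFinB leeB// -[P (~` _)]fineK ?fin_num_measure//; last exact: measurableC.
Qed.

End Reaching_stationarity.

Theorem theorem3 (R : realType) (n : nat) (J : 'rV[R]_n.+1 -> R)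
    (d : measure_display) (T : measurableType d) (P : probability T R)
    (ghat : nat -> 'rV[R]_n.+1 -> T -> 'rV[R]_n.+1)
    (Rs : 'rV[R]_n.+1 -> 'M[R]_n.+1) (w0 : 'rV[R]_n.+1)
    (Jo delta rho beta sigma betaR gamma sigmal : R)
    (delta_gt0 : 0 < delta) (rho_ge0 : 0 <= rho)
    (beta_ge0 : 0 <= beta) (sigma_gt0 : 0 < sigma)
    (gamma_gt0 : 0 < gamma) (gamma_le4 : gamma <= 4) (sigmal_gt0 : 0 < sigmal)
    (hgrad : lipschitz_gradient J delta)
    (hdiff : twice_differentiable J)
    (hhess : lipschitz_hessian J rho)
    (hRs : hoelder_covariance Rs betaR gamma)
    (hJo : forall w, Jo <= J w) :
  exists Cs : R, forall tau p : R, 0 < tau -> 0 < p -> p < 1 ->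
  exists (Cg : R) (r : R -> R),
    r =O_ ((0 : R)^'+) (fun mu : R => mu) /\
    \forall mu \near (0 : R)^'+,
      let w := iterates ghat mu w0 in
      let M := second_order_stationary J delta beta sigma p tau mu in
      let i_s := escape_time n.+1 sigma sigmal tau r mu in
      i_s <= Cs / (mu * tau) /\
      (noise_moments P J ghat w0 beta sigma mu ->
       noise_covariance P J ghat w0 Rs mu ->
       noise_at_saddles J Rs sigmal
         (strict_saddle J delta beta sigma p tau mu) ->
       exists io : T -> nat,
         [/\ measurable_fun setT io,
             forall t, (io t)%:R
               <= (J w0 - Jo) / (mu ^+ 2 * c2 delta sigma * p) * i_s &
             ((1 - p)%:E <= P [set t : T | [/\ M (w (io t) t),
                 enorm (grad J (w (io t) t)) ^+ 2 <= Cg * mu &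
                 - tau <= lambda_min (hess J (w (io t) t))]%R])%E]).
Proof.
pose C2 := c2 delta sigma.
have C20 : 0 < C2 by rewrite mulr_gt0 ?exprn_gt0// divr_gt0.
pose c := 2 * n.+1%:R * (sigma ^+ 2 / sigmal ^+ 2) + 1.
have lc0 : 0 < ln c.
  apply: ln_gt0; rewrite ltrDr; apply: mulr_gt0; first exact: mulr_gt0.
  by apply: divr_gt0; exact: exprn_gt0.
(* The numerator of the escape time with zero remainder, which does not involve [tau] or [p]; it is
   a valid constant because [ln (1 + 2 mu tau) >= mu tau] for small [mu]. *)
exists (ln c) => tau p tau0 p0 p1.
pose Cg := 2 * C2 * (1 + p^-1).
exists Cg, (fun=> 0); split.
  apply/eqO_exP; exists 1 => //; apply: nearW => mu.
  by rewrite normr0 mul1r.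
(* Half of the variance is reserved for the Hoelder error; adding 1 to [|betaR|] avoids division by
   zero. *)
pose eta := sigmal ^+ 2 / 2 / (`|betaR| + 1).
have bR : 0 < `|betaR| + 1 by rewrite ltr_wpDl.
have eta0 : 0 < eta by rewrite divr_gt0// divr_gt0// exprn_gt0.
have [Kg Kg0 hK] := powR_le_expn4 gamma_gt0 gamma_le4 eta0.
have heta : `|betaR| * eta <= sigmal ^+ 2 / 2.
  rewrite /eta mulrCA ler_piMr ?divr_ge0 ?sqr_ge0//.
  by rewrite ler_pdivrMr// mul1r lerDl.
pose kappa := tau ^+ 2 * sigmal ^+ 2 / 4.
have kap0 : 0 < kappa by rewrite divr_gt0// mulr_gt0// exprn_gt0.
pose A0 := 8 * (C2 + 2) / kappa.
pose B := 2 * expR (dist4_rate delta beta sigma Cg * (A0 + 1)).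
have B0 : 0 <= B by rewrite mulr_ge0// expR_ge0.
pose k := Num.min 1 C2.
have k0 : 0 < k by rewrite lt_min ltr01.
pose X1 := delta / 2 * rho ^+ 2 * B + tau ^+ 2 * (`|betaR| * Kg) * B.
pose X2 := kappa / 8 + rho ^+ 2 * B / 2.
have X10 : 0 <= X1.
  by rewrite addr_ge0// mulr_ge0// mulr_ge0 ?sqr_ge0 ?divr_ge0 ?mulr_ge0// ltW.
have X20 : 0 <= X2.
  by rewrite addr_ge0 ?divr_ge0 ?(ltW kap0)// mulr_ge0// sqr_ge0.
have X30 : 0 <= delta * (1 + beta ^+ 2).
  by rewrite mulr_ge0 ?addr_ge0 ?sqr_ge0// ltW.
have tau2 : 0 < 2 * tau by rewrite mulr_gt0.
have X50 : 0 <= C2 / k * (2 * tau) by rewrite ltW// mulr_gt0// divr_gt0.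
near=> mu.
set w := iterates ghat mu w0.
set M := second_order_stationary J delta beta sigma p tau mu.
set i_s := escape_time n.+1 sigma sigmal tau _ mu.
have mu0 : 0 < mu by near: mu; exact: nbhs_right_gt.
have mu1 : mu <= 1 by near: mu; exact: nbhs_right_le.
have hX1 : mu * X1 <= kappa.
  apply: (mulr_le_of_lt_divD1 (ltW mu0) X10).
  by near: mu; apply: nbhs_right_lt; rewrite divr_gt0// ltr_wpDl.
have hX2 : mu * X2 <= 1.
  apply: (mulr_le_of_lt_divD1 (ltW mu0) X20).
  by near: mu; apply: nbhs_right_lt; rewrite divr_gt0// ltr_wpDl.
have hX3 : mu * (delta * (1 + beta ^+ 2)) <= 1.
  apply: (mulr_le_of_lt_divD1 (ltW mu0) X30).
  by near: mu; apply: nbhs_right_lt; rewrite divr_gt0// ltr_wpDl.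
have hc1 : 2^-1 <= c1 delta beta mu by rewrite /c1; lra.
have hX4 : mu * (2 * tau) <= 1.
  apply: (mulr_le_of_lt_divD1 (ltW mu0) (ltW tau2)).
  by near: mu; apply: nbhs_right_lt; rewrite divr_gt0// ltr_wpDl// ltW.
have hX5 : mu * (C2 / k * (2 * tau)) <= ln c.
  apply: (mulr_le_of_lt_divD1 (ltW mu0) X50).
  by near: mu; apply: nbhs_right_lt; rewrite divr_gt0// ltr_wpDl.
have mt0 : 0 < 2 * mu * tau by rewrite !mulr_gt0.
have mt1 : 2 * mu * tau <= 1 by lra.
have ln_lo : mu * tau <= ln (1 + 2 * mu * tau).
  by have := ln1D_ge_half (ltW mt0) mt1; lra.
have ln_hi : ln (1 + 2 * mu * tau) <= 2 * mu * tau.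
  by apply: le_ln1Dx; lra.
have ln_pos : 0 < ln (1 + 2 * mu * tau) by apply: lt_le_trans ln_lo; rewrite mulr_gt0.
have isE : i_s = ln c / ln (1 + 2 * mu * tau) by rewrite /i_s /escape_time addr0.
(* Since [ln (1 + 2 mu tau) <= 2 mu tau], the escape time eventually exceeds the fixed ratio
   [C2 / k]. This is the factor needed to pass from the rate [k] to the rate [C2] in the bound on
   [io]. *)
have is_ge : C2 / k <= i_s.
  rewrite isE ler_pdivlMr//; apply: le_trans (_ : C2 / k * (2 * mu * tau) <= _).
    by rewrite ler_wpM2l// divr_ge0// ltW.
  by apply: le_trans hX5; rewrite le_eqVlt; apply/orP; left; apply/eqP; ring.
split.
  rewrite isE ler_wpM2l ?(ltW lc0)// lef_pV2 ?posrE// mulr_gt0//.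
move=> hmom hcov hns.
have [io [mio iole mIo Pio]] := stationary_hit_probability delta_gt0 rho_ge0
  beta_ge0 sigma_gt0 sigmal_gt0 hgrad hdiff hhess hRs hJo tau0 p0 p1 hK Kg0 heta
  mu0 mu1 hc1 hX1 hX2 hmom hcov hns.
exists io; split => //.
  move=> t; apply: le_trans (iole t) _.
  have -> : (J w0 - Jo) / (mu ^+ 2 * k * p) = (J w0 - Jo) / (mu ^+ 2 * C2 * p) * (C2 / k).
    by field; rewrite !gt_eqF.
  rewrite ler_wpM2l// divr_ge0 ?subr_ge0// ltW// mulr_gt0// mulr_gt0// exprn_gt0//.
rewrite (_ : [set t | _] = [set t | M (w (io t) t)])//.
apply/seteqP; split => t /=; first by case.
move=> Mt; case: (Mt) => nG lt; split => //; last exact: ltW.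
exact: (small_gradient_le mu0 (ltW C20) p0 hc1 nG).
Unshelve. all: by end_near. Qed.
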